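(* Let $\mathcal T$ be a set of tile designs for the rhombic triacontahedron with symmetry group the full icosahedral group $I_h$ (order $120$). Suppose there are $t_{\mathrm{id}}$ tiles, of which $t_r$ are fixed under $180^\circ$ rotation of the rhombic face, $t_f$ are fixed under flipping the face across its short diagonal, and $t_{rf}$ are fixed under flipping the face across its long diagonal. Then the number of ways of tiling the faces of the rhombic triacontahedron up to full icosahedral symmetry $I_h$ is $$\frac{1}{120}\left(t_{\mathrm{id}}^{30}+24t_{\mathrm{id}}^6+20t_{\mathrm{id}}^{10}+15t_{\mathrm{id}}^{14}t_r^2+t_{\mathrm{id}}^{15}+24t_{\mathrm{id}}^3+20t_{\mathrm{id}}^5+15t_{\mathrm{id}}^{13}t_f^2t_{rf}^2\right).$$
   Context: Tilings. Let $P$ be a polyhedron with set of faces $\mathcal F$ and let $\mathcal A$ be a group of isometries of $P$, acting on $\mathcal F$. A set of tile designs is a finite set $\mathcal T$ together with a group action of $\mathcal A$ on $\mathcal T\times\mathcal F$ lying over the action on $\mathcal F$ (so $A\cdot(T,F)=(T',A\cdot F)$ for some $T'\in\mathcal T$). A tiling is a map $\tau:\mathcal F\to\mathcal T$; $\mathcal A$ acts on tilings by moving graphs: $A\cdot\tau$ is the tiling with $((A\cdot\tau)(A\cdot F),A\cdot F)=A\cdot(\tau(F),F)$ for all $F$. The number of ways of tiling up to $\mathcal A$ is the number of $\mathcal A$-orbits on the set of tilings. The induced symmetry group $G$ of a face $F$ is the group of isometries of $F$ realized by elements of the stabilizer $\mathcal A_F$; for $g\in G$, $t_g$ is the number of $T\in\mathcal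 T$ with $g\cdot(T,F)=(T,F)$, where $g$ acts via the element of $\mathcal A_F$ inducing it. Since $\mathcal A$ acts transitively on faces, $t_g$ does not depend on the choice of $F$. In particular $t_{\mathrm{id}}=|\mathcal T|$. Polyhedron and group. Let $\phi=(1+\sqrt5)/2$. Here $\mathcal A=I_h$ is the group of order $120$ generated by $R_0=\mathrm{diag}(-1,1,1)$, $R_2=\mathrm{diag}(1,-1,1)$ and $R_1=\frac12\begin{pmatrix}1-\phi&-\phi&-1\\-\phi&1&1-\phi\\-1&1-\phi&\phi\end{pmatrix}$. The rhombic triacontahedron (dual of the icosidodecahedron) is the convex hull of the $I_h$-orbits of $v=(1,1,1)$ and $v'=(0,1,\phi)$ ($20+12=32$ vertices, $30$ rhombic faces). Each face has two $v$-type vertices (endpoints of its short diagonal) and two $v'$-type vertices (endpoints of its long diagonal). The induced symmetry group of a face is $D_2=\langle r,f\mid r^2=f^2=(rf)^2=e\rangle$, where $r$ is the $180^\circ$ rotation, $f$ swaps the two $v'$-type vertices (fixing the short diagonal pointwise) and $rf$ swaps the two $v$-type vertices (fixing the long diagonal pointwise). *)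

(* Defs.v *)
From HB Require Import structures.
From mathcomp Require Import all_boot all_order all_algebra.
From mathcomp Require Import ring.
From mathcomp Require Import classical_sets boolp functions cardinality reals.
From mathcomp Require Import interval_inference convex.

Set Implicit Arguments.
Unset Strict Implicit.
Unset Printing Implicit Defensive.

Import Order.TTheory GRing.Theory Num.Theory.

Local Open Scope classical_set_scope.
Local Open Scope ring_scope.

Section IcosahedralGroup.
Variable R : realType.

Definition phi : R := (1 + Num.sqrt 5) / 2.

Definition vec3 (a b c : R) : 'cV[R]_3 := \col_(i < 3) [:: a; b; c]`_i.

Definition mx3 (rows : seq (seq R)) : 'M[R]_3 :=
  \matrix_(i < 3, j < 3) (nth [::] rows i)`_j.

Definition R0 : 'M[R]_3 := mx3 [:: [:: -1; 0; 0]; [:: 0; 1; 0]; [:: 0; 0; 1]].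
Definition R2 : 'M[R]_3 := mx3 [:: [:: 1; 0; 0]; [:: 0; -1; 0]; [:: 0; 0; 1]].
Definition R1 : 'M[R]_3 :=
  2^-1 *: mx3 [:: [:: 1 - phi;   - phi;      -1];
                  [::   - phi;       1; 1 - phi];
                  [::      -1; 1 - phi;     phi]].

Definition is_subgroup (G : set 'M[R]_3) : Prop :=
  [/\ forall A, G A -> A \in unitmx,
      G 1%:M,
      forall A B, G A -> G B -> G (A *m B)
    & forall A, G A -> G (invmx A)].

Definition Ih_set : set 'M[R]_3 := smallest is_subgroup [set R0; R1; R2].

Lemma phi_sqr : phi * phi = phi + 1.
Proof.
have s5 : Num.sqrt 5 ^+ 2 = 5 :> R by rewrite sqr_sqrtr ?ler0n.
have -> : phi * phi = (1 + Num.sqrt 5 *+ 2 + Num.sqrt 5 ^+ 2) / 4.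
  by rewrite /phi; field.
by rewrite s5 /phi; field.
Qed.

Lemma mx3_inv (A : 'M[R]_3) :
  (forall i j : 'I_3, A i 0 * A 0 j + A i 1 * A 1 j + A i 2 * A 2 j
     = (i == j)%:R) -> A \in unitmx.
Proof.
move=> h; suff /mulmx1_unit[] : A *m A = 1%:M by [].
apply/matrixP => i j; rewrite !mxE -h !big_ord_recl big_ord0 addr0 addrA.
by congr (_ + _ + _ ); congr (A _ _ * A _ _); apply/val_inj.
Qed.

Lemma Ih_subgroup : is_subgroup Ih_set.
Proof.
have GL : is_subgroup [set A | A \in unitmx].
  split=> //=; [exact: unitmx1| |by move=> A; rewrite unitmx_inv].
  by move=> A B uA uB; rewrite unitmx_mul uA.
have gens : [set R0; R1; R2] `<=` [set A | A \in unitmx].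
  move=> _ [[->|->]|->] /=; apply: mx3_inv;
    case=> -[|[|[|//]]] i; case=> -[|[|[|//]]] j; rewrite !mxE /=.
  all: try by ring.
  all: move: phi phi_sqr => p p2.
  all: try by field: p2.
split.
- by move=> A hA; apply: (hA [set A | A \in unitmx]).
- by move=> G [[]].
- move=> A B hA hB G hG; case: (hG) => -[_ _ hM _] _.
  by apply: hM; [exact: hA|exact: hB].
- move=> A hA G hG; case: (hG) => -[_ _ _ hV] _.
  by apply: hV; exact: hA.
Qed.

End IcosahedralGroup.

Definition Ih (R : realType) : Type := set_type (@Ih_set R).

HB.instance Definition _ (R : realType) := SubType.on (Ih R).
HB.instance Definition _ (R : realType) := Choice.on (Ih R).

Section IhGroup.
Variable R : realType.
Implicit Types g h : Ih R.

Definition mat g : 'M[R]_3 := val g.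

Lemma matP g : Ih_set (mat g).
Proof. exact: set_mem (valP g). Qed.

Lemma mat_inj : injective mat.
Proof. exact: val_inj. Qed.

Lemma mat_unit g : mat g \in unitmx.
Proof. by case: (Ih_subgroup R) => + _ _ _; apply; exact: matP. Qed.

Lemma Ih_set1 : @Ih_set R 1%:M.
Proof. by case: (Ih_subgroup R). Qed.

Lemma Ih_setM (A B : 'M[R]_3) : Ih_set A -> Ih_set B -> Ih_set (A *m B).
Proof. by case: (Ih_subgroup R) => _ _ + _; apply. Qed.

Lemma Ih_setV (A : 'M[R]_3) : Ih_set A -> Ih_set (invmx A).
Proof. by case: (Ih_subgroup R) => _ _ _; apply. Qed.

Definition Ih_one : Ih R := SigSub (mem_set Ih_set1).
Definition Ih_mul g h : Ih R := SigSub (mem_set (Ih_setM (matP g) (matP h))).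
Definition Ih_inv g : Ih R := SigSub (mem_set (Ih_setV (matP g))).

Lemma Ih_mulA : associative Ih_mul.
Proof. by move=> g h k; apply: mat_inj; rewrite /mat /= mulmxA. Qed.

Lemma Ih_mul1 : left_id Ih_one Ih_mul.
Proof. by move=> g; apply: mat_inj; rewrite /mat /= mul1mx. Qed.

Lemma Ih_mulr1 : right_id Ih_one Ih_mul.
Proof. by move=> g; apply: mat_inj; rewrite /mat /= mulmx1. Qed.

Lemma Ih_mulV : left_inverse Ih_one Ih_inv Ih_mul.
Proof. by move=> g; apply: mat_inj; rewrite /mat /= mulVmx ?mat_unit. Qed.

Lemma Ih_mulrV : right_inverse Ih_one Ih_inv Ih_mul.
Proof. by move=> g; apply: mat_inj; rewrite /mat /= mulmxV ?mat_unit. Qed.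

End IhGroup.

HB.instance Definition _ (R : realType) := isGroup.Build (Ih R)
  (@Ih_mulA R) (@Ih_mul1 R) (@Ih_mulr1 R) (@Ih_mulV R) (@Ih_mulrV R).

Section Polyhedron.
Variable R : realType.
Implicit Types (g h : Ih R) (P F : set 'cV[R]_3).

Lemma mat1 : mat (1%g : Ih R) = 1%:M. Proof. by []. Qed.
Lemma matM g h : mat (g * h)%g = mat g *m mat h. Proof. by []. Qed.
Lemma matV g : mat (g^-1)%g = invmx (mat g). Proof. by []. Qed.

Definition Ih_orbit (x : 'cV[R]_3) : set 'cV[R]_3 :=
  range (fun g : Ih R => mat g *m x).

Definition v_vertices : set 'cV[R]_3 := Ih_orbit (vec3 1 1 1).
Definition v'_vertices : set 'cV[R]_3 := Ih_orbit (vec3 0 1 (phi R)).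

Definition convex_hull (S : set 'cV[R]_3) : set 'cV[R]_3 :=
  smallest (@convex_set R 'cV[R]_3) S.

Definition triacontahedron : set 'cV[R]_3 :=
  convex_hull (v_vertices `|` v'_vertices).

(* The intersection of P with a supporting plane; three affinely independent *)
(* points exclude vertices and edges.                                        *)
Definition is_face P F : Prop :=
  (exists (c : 'rV[R]_3) (b : R),
     [/\ c != 0,
         forall x, P x -> (c *m x) 0 0 <= b
       & F = P `&` [set x | (c *m x) 0 0 = b]])
  /\ exists x y z, [/\ F x, F y, F z & \rank (row_mx (y - x) (z - x)) = 2%N].

Definition face_set : set (set 'cV[R]_3) := is_face triacontahedron.

Lemma Ih_orbit_stable (w : 'cV[R]_3) g x :
  Ih_orbit w x -> Ih_orbit w (mat g *m x).
Proof. by case=> h _ <-; exists (g * h)%g; rewrite ?matM ?mulmxA. Qed.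

Lemma triacontahedron_stable g x :
  triacontahedron x -> triacontahedron (mat g *m x).
Proof.
move=> Px C [cC sC]; apply: (Px [set y | C (mat g *m y)]); split.
  move=> y z t /set_mem /= Cy /set_mem /= Cz; apply/mem_set => /=.
  have /set_mem := cC _ _ t (mem_set Cy) (mem_set Cz).
  by congr C; rewrite /conv /= mulmxDr -!scalemxAr.
by move=> y [] /(Ih_orbit_stable g) yV; apply: sC; [left|right].
Qed.

Lemma face_set_stable g F :
  face_set F -> face_set [set mat g *m x | x in F].
Proof.
have KV := mulKVmx (mat_unit g); have K := mulKmx (mat_unit g).
case=> -[c [b [c0 Pb ->]]] [x [y [z [Fx Fy Fz rk]]]]; split.
  exists (c *m invmx (mat g)), b; split.
  - by apply: contra c0 => /eqP e; rewrite -[c](mulmxKV (mat_unit g)) e mul0mx.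
  - by move=> u /(triacontahedron_stable (g^-1)%g); rewrite -mulmxA; exact: Pb.
  - apply/seteqP; split=> u /=.
      move=> [w [Pw cw] <-]; split; first exact: triacontahedron_stable.
      by rewrite -mulmxA K.
    move=> [Pu cu]; exists (invmx (mat g) *m u); last exact: KV.
    by split; [exact: (triacontahedron_stable (g^-1)%g)|rewrite /= mulmxA].
exists (mat g *m x), (mat g *m y), (mat g *m z); split; try by exists x.
- by exists y.
- by exists z.
- rewrite -!mulmxBr -mul_mx_row -mxrank_tr trmx_mul mxrankMfree ?mxrank_tr //.
  by rewrite row_free_unit unitmx_tr mat_unit.
Qed.

End Polyhedron.

Definition faces (R : realType) : Type := set_type (@face_set R).

Section Tilings.
Variable R : realType.
Implicit Types (g h : Ih R) (F : faces R).

Definition pts F : set 'cV[R]_3 := val F.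

Lemma ptsP F : face_set (pts F).
Proof. exact: set_mem (valP F). Qed.

Definition face_act g F : faces R :=
  SigSub (mem_set (face_set_stable g (ptsP F))).

Lemma face_act1 F : face_act 1%g F = F.
Proof.
apply: val_inj; apply/seteqP; split=> x /=.
  by case=> y Fy <-; rewrite mat1 mul1mx.
by move=> Fx; exists x; rewrite ?mat1 ?mul1mx.
Qed.

Lemma face_actM g h F : face_act (g * h)%g F = face_act g (face_act h F).
Proof.
apply: val_inj; apply/seteqP; split=> x /=.
  case=> y Fy <-; exists (mat h *m y); first by exists y.
  by rewrite matM mulmxA.
by case=> _ [y Fy <-] <-; exists y; rewrite ?matM ?mulmxA.
Qed.

Record tile_designs := TileDesigns {
  tile : finType;
  tile_act : Ih R -> tile * faces R -> tile * faces R;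
  tile_act1 : forall x, tile_act 1%g x = x;
  tile_actM : forall g h x, tile_act (g * h)%g x = tile_act g (tile_act h x);
  tile_act_over : forall g x, (tile_act g x).2 = face_act g x.2
}.

Variable D : tile_designs.

Definition tiling : Type := faces R -> tile D.

Definition tiling_act g (tau : tiling) : tiling :=
  fun F => (tile_act g (tau (face_act (g^-1)%g F), face_act (g^-1)%g F)).1.

Lemma tiling_actP g (tau tau' : tiling) :
  tau' = tiling_act g tau <->
  forall F, (tau' (face_act g F), face_act g F) = tile_act g (tau F, F).
Proof.
have KV F : face_act g (face_act (g^-1)%g F) = F.
  by rewrite -face_actM mulgV face_act1.
have K F : face_act (g^-1)%g (face_act g F) = F.
  by rewrite -face_actM mulVg face_act1.
split=> [-> F|tauE].
  by rewrite /tiling_act K [RHS]surjective_pairing tile_act_over.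
by apply/funext => F; rewrite /tiling_act -tauE /= KV.
Qed.

Definition tiling_orbit (tau : tiling) : set tiling :=
  range (fun g : Ih R => tiling_act g tau).

Definition tiling_orbits : set (set tiling) := range tiling_orbit.

Definition induces F g (s : pts F -> pts F) : Prop :=
  face_act g F = F /\ forall x, val (s x) = mat g *m val x.

Definition induced_symmetries F : set (pts F -> pts F) :=
  [set s | exists g, induces g s].

(* At most one g induces a given s, because a face spans the whole space. *)
Definition fixed_tiles F (s : pts F -> pts F) : nat :=
  #|[pred T : tile D |
      `[< exists2 g, induces g s & tile_act g (T, F) = (T, F) >]]|.

Definition half_turn F (s : pts F -> pts F) : Prop :=
  exists c : pts F, forall x, val (s x) = val c *+ 2 - val x.

Definition short_diagonal F : set 'cV[R]_3 :=
  convex_hull (pts F `&` @v_vertices R).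
Definition long_diagonal F : set 'cV[R]_3 :=
  convex_hull (pts F `&` @v'_vertices R).

(* A face contains exactly two points of each of the two vertex orbits. *)
Definition swaps F (V : set 'cV[R]_3) (s : pts F -> pts F) : Prop :=
  forall x y : pts F, V (val x) -> V (val y) -> x <> y -> s x = y.

Definition short_flip F (s : pts F -> pts F) : Prop :=
  swaps (@v'_vertices R) s /\
  forall x : pts F, short_diagonal F (val x) -> s x = x.

Definition long_flip F (s : pts F -> pts F) : Prop :=
  swaps (@v_vertices R) s /\
  forall x : pts F, long_diagonal F (val x) -> s x = x.

End Tilings.

Arguments tiling_orbits [R] D.

(* Main.v *)
Require Import Defs.
From HB Require Import structures.
From mathcomp Require Import all_boot all_order all_algebra all_fingroup.
From mathcomp Require Import ring lra.
From mathcomp Require Import classical_sets boolp functions cardinality reals.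
From mathcomp Require Import interval_inference convex.

(** By Burnside's lemma, the number of tilings up to [I_h] is the average over
    the 120 elements [g] of the number of tilings fixed by [g].

    A tiling is fixed by [g] when [g] carries the tile of each face [F] to the
    tile of [g F].  Such a tiling is determined by its tile on one face of each
    cycle of [g] on the faces; if the cycle has length [n], that tile can be
    any tile fixed by [g ^ n], which maps the face to itself
    ([card_fixed_sections], [card_fixed_tilings]).  The stabilizer of a face
    has four elements, told apart by whether they fix the two corners of the
    face of type [v] and whether they fix the two of type [v'] ([kind],
    [stabilizer_kind_inj]).  Faces being conjugate, the number of tiles fixed
    by a stabilizing element depends on its kind alone ([tiles_fixed_kind]),
    and the four values are [t_id], [t_r], [t_f], [t_rf].  So every [g]
    contributes a monomial in these four numbers, and the formula follows from
    a census of the cycles of the 120 elements ([cycle_census]).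

    What remains is to know the group and the faces explicitly.  The 32
    vertices have coordinates in the ring of golden integers [a + b phi], so
    that equalities and inequalities between their polynomial expressions are
    decided by integer arithmetic.  The three generating mirrors permute the
    vertices, and the permutations that they generate form an explicit list of
    120, in bijection with [I_h] ([vperm_inj], [vperm_onto]).

    The faces are the 30 sections by the planes [n . x = 2 phi], for [n] of
    length 2 along a two-fold axis ([face_is_facet]).  Indeed, let [c . x = b]
    be the supporting plane of a face.  The face is the convex hull of the
    vertices in it.  It spans the plane, and the plane avoids the origin, so
    three of these vertices are linearly independent: otherwise the determinant
    of three points, which is affine in each of them, would vanish on the whole
    face ([supporting_plane_corners]).  By Cramer's rule these three vertices
    determine the plane, and going through all triples of vertices shows that
    each one is linearly dependent, or spans a plane that a fourth vertex lies
    beyond, or lies in one of the 30 planes ([coplanar_nodes]). *)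

Set Implicit Arguments.
Unset Strict Implicit.
Unset Printing Implicit Defensive.

Import Order.TTheory GRing.Theory Num.Theory.

(** * Sections fixed over a permutation *)

Lemma uniq_map_inj_in (T U : eqType) (f : T -> U) (s : seq T) :
  uniq (map f s) -> {in s &, injective f}.
Proof.
elim: s => [//|x s IH] /= /andP[fx /IH{}IH] y z; rewrite !inE.
move=> /predU1P[->|ys] /predU1P[->|zs] // e; last exact: IH.
- by rewrite e map_f in fx.
- by rewrite -e map_f in fx.
Qed.

Lemma uniq_flatten_index (T : eqType) (ss : seq (seq T)) x i j :
  uniq (flatten ss) -> i < size ss -> j < size ss ->
  x \in nth [::] ss i -> x \in nth [::] ss j -> i = j.
Proof.
elim: ss i j => [//|s ss IH] i j /=; rewrite cat_uniq => /and3P[_ /hasPn disj uss].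
have out k : k < size ss -> x \in nth [::] ss k -> x \notin s.
  move=> hk hx; apply: disj; apply/flattenP.
  by exists (nth [::] ss k); rewrite ?mem_nth.
case: i j => [|i] [|j] //= hi hj xi xj.
- by have := out _ hj xj; rewrite xi.
- by have := out _ hi xi; rewrite xj.
- by congr _.+1; exact: IH.
Qed.

Section FixedSections.
Variables (X T : finType) (p : X -> X) (a : T * X -> T * X).
Hypothesis a_over : forall z, (a z).2 = p z.2.
Variable s : seq (X * nat).
Hypothesis s_cover : perm_eq (flatten [seq traject p c.1 c.2 | c <- s]) (enum X).
Hypothesis s_return : forall c, c \in s -> 0 < c.2 /\ iter c.2 p c.1 = c.1.

(** The tile on the first face [c.1] of each cycle [c] is subject to one
    condition, that going once round the cycle brings it back; then it
    determines the tiles on the rest of the cycle.  The cycles are given by a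
    list of starting points and lengths, which a computation can provide. *)
Lemma card_fixed_sections :
  #|[set tau : {ffun X -> T} | [forall x, a (tau x, x) == (tau (p x), p x)]]|
  = \prod_(c <- s) #|[pred t | iter c.2 a (t, c.1) == (t, c.1)]|.
Proof.
pose c (i : 'I_(size s)) := tnth (in_tuple s) i.
have cE d i : c i = nth d s i by exact: tnth_nth.
have c_in i : c i \in s by exact: mem_tnth.
set Fix := [set tau | _].
have FixP (tau : {ffun X -> T}) :
    reflect (forall x, a (tau x, x) = (tau (p x), p x)) (tau \in Fix).
  by rewrite inE; exact: 'forall_eqP.
have iter_fix tau n x : tau \in Fix ->
    iter n a (tau x, x) = (tau (iter n p x), iter n p x).
  by move=> /FixP h; elim: n => [//|n IH]; rewrite !iterS IH h.
have iter2 n z : (iter n a z).2 = iter n p z.2.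
  by elim: n => [//|n IH]; rewrite !iterS a_over IH.
(* The value off the index type is the default of [nth]. *)
have nth_c i : nth [::] [seq traject p d.1 d.2 | d <- s] i =
    if insub i is Some k then traject p (c k).1 (c k).2 else [::].
  case: insubP => [k _ <-|]; last first.
    by rewrite -leqNgt => h; rewrite nth_default ?size_map.
  rewrite (nth_map (c k)); last exact: ltn_ord.
  by have <- : c k = nth (c k) s (val k) := cE _ _.
have locate y : exists ij : 'I_(size s) * nat,
    ij.2 < (c ij.1).2 /\ y = iter ij.2 p (c ij.1).1.
  have : y \in flatten [seq traject p d.1 d.2 | d <- s].
    by rewrite (perm_mem s_cover) mem_enum.
  move=> /flatten_mapP[d /(nthP d)[i hi <-]] /trajectP[j hj ->].
  by exists (Ordinal hi, j); rewrite /= (cE d).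
have unique i j i' j' : j < (c i).2 -> j' < (c i').2 ->
    iter j p (c i).1 = iter j' p (c i').1 -> i = i' /\ j = j'.
  move=> hj hj' e.
  have u : uniq (flatten [seq traject p d.1 d.2 | d <- s]).
    by rewrite (perm_uniq s_cover) enum_uniq.
  have ii' : i = i'.
    apply: val_inj; apply: (uniq_flatten_index (x := iter j p (c i).1) u);
      rewrite ?size_map ?ltn_ord // nth_c valK; apply/trajectP; first by exists j.
    by exists j'.
  split=> //; rewrite -{}ii' {i'} in hj' e.
  have ut : uniq (traject p (c i).1 (c i).2).
    have mem_ci : traject p (c i).1 (c i).2 \in [seq traject p d.1 d.2 | d <- s].
      by apply/mapP; exists (c i).
    case/path.splitPr: mem_ci u => s1 s2; rewrite flatten_cat cat_uniq /= cat_uniq.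
    by case/and3P=> _ _ /andP[].
  apply/eqP; rewrite -(nth_uniq (c i).1 _ _ ut) ?size_traject //.
  by rewrite !nth_traject // e.
(* A fixed section is identified with its values at the starting points. *)
pose fwd (tau : {ffun X -> T}) : {ffun 'I_(size s) -> T} := [ffun i => tau (c i).1].
pose A i := [pred t | iter (c i).2 a (t, (c i).1) == (t, (c i).1)].
have fwd_inj : {in Fix &, injective fwd}.
  move=> tau tau' ht ht' /ffunP e; apply/ffunP => y.
  have [[i j] /= [_ ->]] := locate y.
  have := iter_fix tau j (c i).1 ht; have := iter_fix tau' j (c i).1 ht'.
  by have := e i; rewrite !ffunE => -> -> [].
rewrite -(card_in_imset fwd_inj) big_tnth.
transitivity #|family A|; last by rewrite card_family foldrE big_map big_enum.
apply: eq_card => m; apply/imsetP/familyP => [[tau ht ->] i|mA].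
  have [_ ci] := s_return (c_in i).
  by rewrite ffunE inE iter_fix// ci.
(* Conversely, allowed values at the starting points are transported along the
   cycles. *)
have /fin_all_exists[loc locP] := locate.
pose orb (i : 'I_(size s)) j := iter j a (m i, (c i).1).
pose tau := [ffun y => (orb (loc y).1 (loc y).2).1].
have tauE i j : j < (c i).2 -> tau (iter j p (c i).1) = (orb i j).1.
  move=> hj; rewrite ffunE; have [hl e] := locP (iter j p (c i).1).
  by have [e1 e2] := unique _ _ _ _ hj hl e; rewrite -e1 -e2.
exists tau; last first.
  by apply/ffunP => i; rewrite ffunE (tauE i 0)//; case: (s_return (c_in i)).
apply/FixP => y; have [[i j] /= [hj ->]] := locate y.
have orbE k : orb i k = ((orb i k).1, iter k p (c i).1).
  by rewrite [LHS]surjective_pairing /orb iter2.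
rewrite tauE// -orbE -[a _]/(orb i j.+1) -iterS orbE; congr pair.
(* Either [p] moves on along the cycle, or it closes the cycle. *)
have [lt|ge] := ltnP j.+1 (c i).2; first by rewrite tauE.
have eq : j.+1 = (c i).2 by apply/eqP; rewrite eqn_leq hj.
have [c0 ci] := s_return (c_in i).
rewrite eq ci -[(c i).1 in RHS]/(iter 0 p (c i).1) tauE//.
by have /eqP mi := mA i; rewrite /orb mi.
Qed.

End FixedSections.

(** * Exact arithmetic in the golden integers *)

Section Golden.
Local Open Scope ring_scope.

(** [(a, b)] stands for [a + b phi]. *)
Definition golden : Type := (int * int)%type.

Definition gadd (x y : golden) : golden := (x.1 + y.1, x.2 + y.2).

Definition gopp (x : golden) : golden := (- x.1, - x.2).

Definition gsub (x y : golden) : golden := gadd x (gopp y).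

(** This is [phi ^ 2 = phi + 1]. *)
Definition gmul (x y : golden) : golden :=
  let p := x.2 * y.2 in (x.1 * y.1 + p, x.1 * y.2 + x.2 * y.1 + p).

(** Only a sufficient test of positivity, from the bounds
    [21 / 13 < phi < 34 / 21] by consecutive Fibonacci quotients, which are
    sharp enough for all the numbers that occur below. *)
Definition gpos (x : golden) : bool :=
  if 0 <= x.2 then 0 < 13 * x.1 + 21 * x.2 else 0 < 21 * x.1 + 34 * x.2.

Definition gvec : Type := (golden * golden * golden)%type.

Definition gvadd (u v : gvec) : gvec :=
  (gadd u.1.1 v.1.1, gadd u.1.2 v.1.2, gadd u.2 v.2).

Definition gvsub (u v : gvec) : gvec :=
  (gsub u.1.1 v.1.1, gsub u.1.2 v.1.2, gsub u.2 v.2).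

Definition gdot (u v : gvec) : golden :=
  gadd (gadd (gmul u.1.1 v.1.1) (gmul u.1.2 v.1.2)) (gmul u.2 v.2).

Definition gcross (u v : gvec) : gvec :=
  (gsub (gmul u.1.2 v.2) (gmul u.2 v.1.2),
   gsub (gmul u.2 v.1.1) (gmul u.1.1 v.2),
   gsub (gmul u.1.1 v.1.2) (gmul u.1.2 v.1.1)).

(** A normal vector of the plane through the points [u], [v], [w]. *)
Definition gplane (u v w : gvec) : gvec :=
  gvadd (gvadd (gcross v w) (gcross w u)) (gcross u v).

Definition g0 : golden := (0, 0).
Definition g1 : golden := (1, 0).
Definition g2 : golden := (2, 0).
Definition gphi : golden := (0, 1).
(** The inverse of [phi]. *)
Definition gphiV : golden := (-1, 1).

End Golden.

(** * The vertices, faces and symmetries as finite lists *)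

Definition signings (u : gvec) : seq gvec :=
  let pm x := [:: x; gopp x] in
  [seq (w, z) | w <- [seq (x, y) | x <- pm u.1.1, y <- pm u.1.2], z <- pm u.2].

Definition cyclic_signings (u : gvec) : seq gvec :=
  undup (flatten [seq signings w |
    w <- [:: u; (u.2, u.1.1, u.1.2); (u.1.2, u.2, u.1.1)]]).

(** The orbit of [(1, 1, 1)] is the vertex set of a dodecahedron, which comes
    first and occupies the positions below 20; that of [(0, 1, phi)] is the
    vertex set of an icosahedron. *)
Definition nodes : seq gvec :=
  cyclic_signings (g1, g1, g1) ++ cyclic_signings (gphi, gphiV, g0)
  ++ cyclic_signings (g0, g1, gphi).

Definition node (l : nat) : gvec := nth (g0, g0, g0) nodes l.

Definition first_v' : nat := index (g0, g1, gphi) nodes.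

(** The vectors of length 2 along the two-fold axes. *)
Definition normals : seq gvec :=
  cyclic_signings (g0, g0, g2) ++ cyclic_signings (gphi, g1, gphiV).

Definition height : golden := gmul g2 gphi.

(** A face is represented by the increasing list of its four corners, so that
    faces can be compared by comparing lists. *)
Definition corners (n : gvec) : seq nat :=
  [seq l <- iota 0 32 | gdot n (node l) == height].

Definition rhombi : seq (seq nat) := map corners normals.

(** Twice the matrices of the generators, to have golden integers as
    entries. *)
Definition doubled_mirror (i : nat) : gvec * gvec * gvec :=
  nth ((g0, g0, g0), (g0, g0, g0), (g0, g0, g0))
    [:: ((gopp g2, g0, g0), (g0, g2, g0), (g0, g0, g2));
        ((gsub g1 gphi, gopp gphi, gopp g1), (gopp gphi, g1, gsub g1 gphi),
         (gopp g1, gsub g1 gphi, gphi));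
        ((g2, g0, g0), (g0, gopp g2, g0), (g0, g0, g2))] i.

Definition gmulmx (m : gvec * gvec * gvec) (u : gvec) : gvec :=
  (gdot m.1.1 u, gdot m.1.2 u, gdot m.2 u).

Definition mirror_perm (i : nat) : seq nat :=
  [seq find (fun w => gvadd w w == gmulmx (doubled_mirror i) u) nodes
     | u <- nodes].

Definition mirror_perms : seq (seq nat) := map mirror_perm (iota 0 3).

Definition perm_comp (p q : seq nat) : seq nat := map (nth 0 p) q.

Definition idperm : seq nat := iota 0 32.

Definition perm_pow (p : seq nat) (n : nat) : seq nat := iter n (perm_comp p) idperm.

(** Breadth-first enumeration of a group from its generators: the first list
    holds the words that are done, the second those of the next length. *)
Definition grow (s : seq (seq nat) * seq (seq nat)) :=
  let old := s.1 ++ s.2 in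
  (old, undup [seq p <- [seq perm_comp m p | m <- mirror_perms, p <- s.2]
               | p \notin old]).

(** The longest element of the icosahedral reflection group has length 15. *)
Definition elements : seq (seq nat) := (iter 16 grow ([::], [:: idperm])).1.

Definition face_image (p q : seq nat) : seq nat :=
  [seq l <- iota 0 32 | l \in map (nth 0 p) q].

(** Whether [p] fixes the dodecahedral corners of [q], and whether it fixes the
    icosahedral ones. *)
Definition fixtype (p q : seq nat) : bool * bool :=
  (all (fun l => (l < 20) ==> (nth 0 p l == l)) q,
   all (fun l => (20 <= l) ==> (nth 0 p l == l)) q).

(** No element of the group has order greater than 10. *)
Definition cycle_length (p q : seq nat) : nat :=
  (find (pred1 q) (traject (face_image p) (face_image p q) 10)).+1.

Definition cycles (p : seq nat) : seq (seq nat * nat) :=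
  (foldl (fun acc q => if q \in acc.2 then acc else
            let n := cycle_length p q in
            ((q, n) :: acc.1, traject (face_image p) q n ++ acc.2))
         ([::], [::]) rhombi).1.

Definition cycle_types (p : seq nat) : seq (bool * bool) :=
  [seq fixtype (perm_pow p c.2) c.1 | c <- cycles p].

(** How many cycles of [p] on the faces come back by the identity, by a
    half-turn, by a flip across the short diagonal and by one across the long
    diagonal. *)
Definition exponents (p : seq nat) : nat * nat * nat * nat :=
  let t := cycle_types p in
  (count_mem (true, true) t, count_mem (false, false) t,
   count_mem (true, false) t, count_mem (false, true) t).

(** The squared distance of two vertices is a golden integer, whose positivity
    can be tested. *)
Lemma nodes_separated l k : l < 32 -> k < 32 -> l != k ->
  gpos (gdot (gvsub (node l) (node k)) (gvsub (node l) (node k))).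
Proof.
have : all (fun l => all (fun k => (l == k) ||
    let d := gvsub (node l) (node k) in gpos (gdot d d))
  (iota 0 32)) (iota 0 32) by vm_compute.
move=> /allP + hl hk => /(_ l); rewrite mem_iota => /(_ hl) /allP/(_ k).
by rewrite mem_iota => /(_ hk) /orP[->|].
Qed.

Lemma nodes_opposite l : l < 32 ->
  exists2 k, k < 32 & node k = gvsub (g0, g0, g0) (node l).
Proof.
have : all (fun l => has (fun k => node k == gvsub (g0, g0, g0) (node l))
  (iota 0 32)) (iota 0 32) by vm_compute.
move=> /allP + hl => /(_ l); rewrite mem_iota => /(_ hl) /hasP[k].
by rewrite mem_iota => hk /eqP; exists k.
Qed.

Lemma normals_support n l : n \in normals -> l < 32 ->
  gdot n (node l) = height \/ gpos (gsub height (gdot n (node l))).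
Proof.
have : all (fun n => all (fun l => (gdot n (node l) == height) ||
  gpos (gsub height (gdot n (node l)))) (iota 0 32)) normals by vm_compute.
move=> /allP + hn hl => /(_ n hn) /allP /(_ l); rewrite mem_iota.
by move=> /(_ hl) /orP[/eqP|]; [left|right].
Qed.

Lemma rhombi_normal q : q \in rhombi -> exists2 n, n \in normals & q = corners n.
Proof. by move=> /mapP. Qed.

Lemma corners_rhombi n : n \in normals -> corners n \in rhombi.
Proof. exact: map_f. Qed.

Lemma rhombi_uniq : uniq rhombi.
Proof. by vm_compute. Qed.

Lemma corners_inj : {in normals &, injective corners}.
Proof. exact: uniq_map_inj_in rhombi_uniq. Qed.

(** In the second case, [gdot n (node l) - d] has the sign of the determinant
    [d], which means that the vertex [l] and the origin lie on opposite sides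
    of the plane through [i], [j], [k]: that plane does not support the
    polyhedron.  The test covers the 4960 triples of vertices. *)
Lemma coplanar_nodes i j k : i < j -> j < k -> k < 32 ->
  let n := gplane (node i) (node j) (node k) in
  let d := gdot n (node i) in
  [\/ d = g0,
      exists2 l, l < 32 & gpos (gmul d (gsub (gdot n (node l)) d))
    | exists2 q, q \in rhombi & [/\ i \in q, j \in q & k \in q]].
Proof.
have : all (fun k => all (fun j => all (fun i =>
    let n := gplane (node i) (node j) (node k) in
    let d := gdot n (node i) in
    [|| d == g0,
        has (fun l => gpos (gmul d (gsub (gdot n (node l)) d))) (iota 0 32)
      | has (fun q => [&& i \in q, j \in q & k \in q]) rhombi])
  (iota 0 j)) (iota 0 k)) (iota 0 32) by vm_compute.
move=> /allP + ij jk k32 => /(_ k); rewrite mem_iota => /(_ k32).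
move=> /allP /(_ j); rewrite mem_iota => /(_ jk).
move=> /allP /(_ i); rewrite mem_iota => /(_ ij) /or3P[/eqP|/hasP[l]|/hasP[q]].
- by move=> h; constructor 1.
- by rewrite mem_iota => hl h; constructor 2; exists l.
- by move=> hq /and3P h; constructor 3; exists q.
Qed.

Lemma mirror_permP i l : i < 3 -> l < 32 ->
  nth 0 (mirror_perm i) l < 32 /\
  gvadd (node (nth 0 (mirror_perm i) l)) (node (nth 0 (mirror_perm i) l))
    = gmulmx (doubled_mirror i) (node l).
Proof.
have : all (fun i => all (fun l => let k := nth 0 (mirror_perm i) l in
   (k < 32) && (gvadd (node k) (node k) == gmulmx (doubled_mirror i) (node l)))
   (iota 0 32)) (iota 0 3) by vm_compute.
move=> /allP + hi hl => /(_ i); rewrite mem_iota => /(_ hi).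
by move=> /allP /(_ l); rewrite mem_iota => /(_ hl) /andP[? /eqP].
Qed.

Lemma elements_uniq : uniq elements.
Proof. by vm_compute. Qed.

Lemma size_elements : size elements = 120.
Proof. by vm_compute. Qed.

Lemma elements_id : idperm \in elements.
Proof. by vm_compute. Qed.

Lemma elements_mirror i p : i < 3 -> p \in elements ->
  perm_comp (mirror_perm i) p \in elements.
Proof.
have : all (fun i => let m := mirror_perm i in
  all (fun p => perm_comp m p \in elements) elements) (iota 0 3) by vm_compute.
move=> /allP + hi hp => /(_ i); rewrite mem_iota => /(_ hi).
by move=> /allP; apply.
Qed.

(** Every listed permutation is a word in the mirrors. *)
Lemma elements_ind (P : seq nat -> Prop) :
  P idperm -> (forall i p, i < 3 -> P p -> P (perm_comp (mirror_perm i) p)) ->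
  forall p, p \in elements -> P p.
Proof.
move=> P1 PM; rewrite /elements.
have : forall n, {in (iter n grow ([::], [:: idperm])).1, forall p, P p} /\
                 {in (iter n grow ([::], [:: idperm])).2, forall p, P p}.
  elim=> [|n]; first by split=> p //; rewrite inE => /eqP->.
  rewrite iterS; case: (iter n _ _) => s t [Ps Pt]; split=> p.
    by rewrite mem_cat => /orP[/Ps|/Pt].
  rewrite mem_undup mem_filter => /andP[_] /allpairsP[[m q] [/mapP[i hi ->] hq ->]].
  by apply: PM; [move: hi; rewrite mem_iota|exact: Pt].
move=> /(_ 16)[h _]; exact: h.
Qed.

Lemma elements_bound p l : p \in elements -> l < 32 -> nth 0 p l < 32.
Proof.
have : all (fun p => all (fun l => nth 0 p l < 32) (iota 0 32)) elements
  by vm_compute.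
by move=> /allP + hp hl => /(_ p hp) /allP/(_ l); rewrite mem_iota; apply.
Qed.

(** The group preserves the two types of vertices.  With
    [elements_transitive], each type is one orbit. *)
Lemma elements_orbits p : p \in elements ->
  nth 0 p 0 < 20 /\ 20 <= nth 0 p first_v'.
Proof.
have : all (fun p => (nth 0 p 0 < 20) && (20 <= nth 0 p first_v')) elements
  by vm_compute.
by move=> /allP + hp => /(_ p hp) /andP.
Qed.

Lemma elements_transitive l : l < 32 ->
  exists2 p, p \in elements & nth 0 p (if l < 20 then 0 else first_v') = l.
Proof.
have : all (fun l => has (fun p =>
  nth 0 p (if l < 20 then 0 else first_v') == l) elements) (iota 0 32)
  by vm_compute.
move=> /allP + hl => /(_ l); rewrite mem_iota => /(_ hl) /hasP[p hp /eqP].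
by exists p.
Qed.

Lemma rhombi_transitive q q' : q \in rhombi -> q' \in rhombi ->
  exists2 p, p \in elements & face_image p q = q'.
Proof.
move=> hq hq'.
(* The list [s] is shared to be computed only once for each [q]. *)
have trans : all (fun q =>
  let s := [seq face_image p q | p <- elements] in
  all (fun q' => q' \in s) rhombi) rhombi by vm_compute.
have/(_ q hq) := elimT allP trans; cbv beta zeta => {}trans.
have/(_ q' hq') := elimT allP trans; cbv beta.
case/mapP=> p hp ->.
by exists p.
Qed.

Lemma rhombi_corners q : q \in rhombi ->
  size [seq l <- q | l < 20] = 2 /\ size [seq l <- q | 20 <= l] = 2.
Proof.
have : all (fun q => (size [seq l <- q | l < 20] == 2) &&
  (size [seq l <- q | 20 <= l] == 2)) rhombi by vm_compute.
move=> /allP + hq => /(_ q hq) /andP[/eqP h /eqP h'].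
by split; [exact: h|exact: h'].
Qed.

(** The elements of the stabilizer of a face are told apart by the corners that
    they fix. *)
Lemma rhombi_stabilizers q : q \in rhombi ->
  uniq [seq fixtype p q | p <- elements & face_image p q == q].
Proof.
have : all (fun q => uniq [seq fixtype p q | p <- elements & face_image p q == q])
  rhombi by vm_compute.
move=> /allP/(_ q)/[apply] h; exact: h.
Qed.

(** The lists of cycles meet the hypotheses of [card_fixed_sections]. *)
Lemma cyclesP p : p \in elements ->
  perm_eq (flatten [seq traject (face_image p) c.1 c.2 | c <- cycles p]) rhombi /\
  forall c, c \in cycles p -> 0 < c.2 /\ iter c.2 (face_image p) c.1 = c.1.
Proof.
have : all (fun p => let s := cycles p in
  perm_eq (flatten [seq traject (face_image p) c.1 c.2 | c <- s]) rhombi &&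
  all (fun c => (0 < c.2) && (iter c.2 (face_image p) c.1 == c.1)) s) elements
  by vm_compute.
move=> /allP/(_ p)/[apply] /andP[h1 /allP h2]; split; first exact: h1.
by move=> c /h2 /andP[hc /eqP e]; split; [exact: hc|exact: e].
Qed.

(** The rows are, in order: the identity, the rotations of order 5, 3 and 2, the
    central inversion, the rotary reflections of order 10 and 6, and the
    reflections.  The face cycles of a half-turn have length 2, except the two
    faces on its axis; those of a reflection have length 2, except the four
    faces that its mirror cuts along a diagonal. *)
Lemma cycle_census : perm_eq [seq exponents p | p <- elements]
  (nseq 1 (30, 0, 0, 0) ++ nseq 24 (6, 0, 0, 0) ++ nseq 20 (10, 0, 0, 0)
   ++ nseq 15 (14, 2, 0, 0) ++ nseq 1 (15, 0, 0, 0) ++ nseq 24 (3, 0, 0, 0)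
   ++ nseq 20 (5, 0, 0, 0) ++ nseq 15 (13, 0, 2, 2)).
Proof. by vm_compute. Qed.

Lemma nodes_signed_cube : all (fun u => u \in nodes)
  [:: (g1, g1, g1); (g1, g1, gopp g1); (g1, gopp g1, g1); (gopp g1, g1, g1)].
Proof. by vm_compute. Qed.

Lemma node_index u : u \in nodes ->
  exists2 l, l < 32 & node l = u.
Proof.
move=> hu; exists (index u nodes); last exact: nth_index.
have <- : size nodes = 32 by vm_compute.
by rewrite index_mem.
Qed.

Lemma node_first : node 0 = (g1, g1, g1).
Proof. by vm_compute. Qed.

Lemma first_v'P : first_v' < 32 /\ node first_v' = (g0, g1, gphi).
Proof. by vm_compute. Qed.

Lemma elements_size p : p \in elements -> size p = 32.
Proof.
have : all (fun p => size p == 32) elements by vm_compute.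
by move=> /allP + hp => /(_ p hp) /eqP.
Qed.

(* Conversion would otherwise try to evaluate these lists without the help of
   bytecode. *)
Global Opaque first_v' nodes normals rhombi elements mirror_perm.

(** * Evaluation in the real numbers *)

Section Evaluation.
Local Open Scope classical_set_scope.
Local Open Scope ring_scope.

Variable R : realType.

Definition ev (x : golden) : R := x.1%:~R + x.2%:~R * phi R.

Lemma evD x y : ev (gadd x y) = ev x + ev y.
Proof. by rewrite /ev !intrD; ring. Qed.

Lemma evN x : ev (gopp x) = - ev x.
Proof. by rewrite /ev !intrN; ring. Qed.

Lemma evB x y : ev (gsub x y) = ev x - ev y.
Proof. by rewrite evD evN. Qed.

Lemma evM x y : ev (gmul x y) = ev x * ev y.
Proof.
by rewrite /ev !(intrD, intrM) /=; move: (@phi_sqr R) => h; ring: h.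
Qed.

Lemma phi_lt : phi R < 34%:R / 21%:R.
Proof.
have s0 : 0 <= Num.sqrt 5 :> R by exact: sqrtr_ge0.
have s2 : Num.sqrt 5 ^+ 2 = 5 :> R by rewrite sqr_sqrtr ?ler0n.
rewrite /phi; nra.
Qed.

Lemma phi_gt : 21%:R / 13%:R < phi R.
Proof.
have s0 : 0 <= Num.sqrt 5 :> R by exact: sqrtr_ge0.
have s2 : Num.sqrt 5 ^+ 2 = 5 :> R by rewrite sqr_sqrtr ?ler0n.
rewrite /phi; nra. Qed.

Lemma ev_gt0 x : gpos x -> 0 < ev x.
Proof.
rewrite /gpos /ev; case: x => a b /=; have := phi_lt; have := phi_gt.
case: ifP => [|/negbT]; rewrite -?ltNge -!(ltr_int R) -?(ler_int R) !(intrD, intrM) /=.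
  by nra.
by nra.
Qed.

Definition evv (u : gvec) : 'cV[R]_3 := vec3 (ev u.1.1) (ev u.1.2) (ev u.2).
Definition dot (c : 'rV[R]_3) (x : 'cV[R]_3) : R := (c *m x) 0 0.

Lemma dotE c x : dot c x = c 0 0 * x 0 0 + c 0 1 * x 1 0 + c 0 2 * x 2 0.
Proof.
rewrite /dot mxE !big_ord_recl big_ord0 addr0 addrA.
by congr (_ + _ + _ ); congr (c _ _ * x _ _); apply/val_inj.
Qed.

Lemma evvE u : (evv u 0 0 = ev u.1.1) * (evv u 1 0 = ev u.1.2) * (evv u 2 0 = ev u.2).
Proof. by rewrite !mxE. Qed.

Lemma cV3_eq (x y : 'cV[R]_3) :
  x 0 0 = y 0 0 -> x 1 0 = y 1 0 -> x 2 0 = y 2 0 -> x = y.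
Proof.
move=> h0 h1 h2; apply/matrixP => i j; rewrite ord1.
by case: i => -[|[|[|//]]] hi; [move: h0|move: h1|move: h2];
  congr (x _ _ = y _ _); apply/val_inj.
Qed.

Lemma ev_gdot u v : ev (gdot u v) = dot (evv u)^T (evv v).
Proof. by rewrite dotE ![_^T _ _]mxE !evvE !(evD, evM). Qed.

Lemma dotD c x y : dot c (x + y) = dot c x + dot c y.
Proof. by rewrite /dot mulmxDr mxE. Qed.

Lemma dotZ c k x : dot c (k *: x) = k * dot c x.
Proof. by rewrite /dot -scalemxAr mxE. Qed.

Lemma dotB c x y : dot c (x - y) = dot c x - dot c y.
Proof. by rewrite /dot mulmxBr !mxE. Qed.

Definition vol (x y z : 'cV[R]_3) : R :=
  x 0 0 * (y 1 0 * z 2 0 - y 2 0 * z 1 0)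
  + x 1 0 * (y 2 0 * z 0 0 - y 0 0 * z 2 0)
  + x 2 0 * (y 0 0 * z 1 0 - y 1 0 * z 0 0).

(** For fixed [u], [v], [w], the linear form in [x] that takes the value
    [vol u v w] at each of the three points. *)
Definition plane (u v w x : 'cV[R]_3) : R := vol x v w + vol u x w + vol u v x.

Lemma plane_at u v w : plane u v w u = vol u v w.
Proof. rewrite /plane /vol; ring. Qed.

(** Cramer's rule: a linear form is determined by its values at three linearly
    independent points. *)
Lemma cramer c u v w x :
  vol u v w * dot c x
  = dot c u * vol x v w + dot c v * vol u x w + dot c w * vol u v x.
Proof. rewrite !dotE /vol; ring. Qed.

Lemma cramer_plane c b u v w x : dot c u = b -> dot c v = b -> dot c w = b ->
  vol u v w * dot c x = b * plane u v w x.
Proof. by move=> hu hv hw; rewrite cramer hu hv hw /plane; ring. Qed.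

Lemma ev_plane u v w x :
  ev (gdot (gplane u v w) x) = plane (evv u) (evv v) (evv w) (evv x).
Proof.
rewrite /plane /vol !evvE !(evD, evM, evB, evN) /=.
ring. Qed.

(** The product of two determinants is the determinant of the product. *)
Lemma vol_gram (a b c : 'rV[R]_3) (x y z : 'cV[R]_3) :
  vol a^T b^T c^T * vol x y z =
  dot a x * (dot b y * dot c z - dot b z * dot c y)
  + dot b x * (dot c y * dot a z - dot c z * dot a y)
  + dot c x * (dot a y * dot b z - dot a z * dot b y).
Proof. rewrite !dotE /vol ![_^T _ _]mxE. ring. Qed.

(** The form [c] and the two rows of a left inverse of the direction matrix
    [(y - x, z - x)] take at [x], [y - x], [z - x] the values of a triangular
    matrix with diagonal [b], 1, 1. *)
Lemma vol_neq0 c b x y z : b != 0 -> dot c x = b -> dot c y = b -> dot c z = b ->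
  \rank (row_mx (y - x) (z - x)) = 2%N -> vol x y z != 0.
Proof.
move=> b0 cx cy cz rk.
have /row_fullP[B BE] : row_full (row_mx (y - x) (z - x)) by apply/eqP.
have dotr (i : 'I_(1 + 1)) j : dot (row i B) j = (B *m j) i 0.
  by rewrite /dot -row_mul mxE.
have E : vol c^T (row 0 B)^T (row 1 B)^T * vol x (y - x) (z - x) = b.
  rewrite vol_gram cx !(dotB c) cx cy cz !subrr !dotr.
  move: BE; rewrite mul_mx_row => /matrixP BE.
  have := BE 0 (lshift 1 0); rewrite row_mxEl [1%:M _ _]mxE /= => ->.
  have := BE 0 (rshift 1 0); rewrite row_mxEr [1%:M _ _]mxE /= => ->.
  have := BE 1 (lshift 1 0); rewrite row_mxEl [1%:M _ _]mxE /= => ->.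
  have := BE 1 (rshift 1 0); rewrite row_mxEr [1%:M _ _]mxE /= => ->.
  by ring.
have -> : vol x y z = vol x (y - x) (z - x) by rewrite /vol !mxE; ring.
by apply: contra b0 => /eqP v0; rewrite -E v0 mulr0.
Qed.

(** * Convexity *)

Lemma convex_hull_sub (S Q : set 'cV[R]_3) : S `<=` Q ->
  (forall x y (t : R), 0 < t -> t < 1 -> Q x -> Q y -> Q (t *: x + (1 - t) *: y)) ->
  convex_hull S `<=` Q.
Proof.
move=> SQ Qconv; apply: smallest_sub => //.
apply/convex_setW => x y /set_mem Qx /set_mem Qy k k0 k1.
by apply/mem_set; apply: Qconv.
Qed.

(** A proper convex combination of points of the half-space lies in the
    boundary plane only if both points do; so the section of a convex hull by a
    supporting plane is generated by the generators that it contains. *)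
Lemma supporting_slice_sub (S Q : set 'cV[R]_3) c b :
  (forall x, S x -> dot c x <= b) -> (forall x, S x -> dot c x = b -> Q x) ->
  (forall x y (t : R), Q x -> Q y -> Q (t *: x + (1 - t) *: y)) ->
  forall x, convex_hull S x -> dot c x = b -> Q x.
Proof.
move=> Sb SQ Qconv x Hx.
suff [] : dot c x <= b /\ (dot c x = b -> Q x) by [].
move: x Hx.
apply: (convex_hull_sub (Q := [set x | dot c x <= b /\ (dot c x = b -> Q x)])).
  by move=> x Sx; split; [exact: Sb|exact: SQ].
move=> x y t t0 t1 /= [xb xQ] [yb yQ]; rewrite dotD !dotZ; split; first by nra.
by move=> e; apply: Qconv; [apply: xQ; nra|apply: yQ; nra].
Qed.

Lemma evv_double u v : gvadd u u = v -> evv v = 2 *: evv u.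
Proof.
by move=> <-; apply: cV3_eq; rewrite !mxE /= evD; ring.
Qed.

Lemma evv_sub u v : evv (gvsub u v) = evv u - evv v.
Proof. by apply: cV3_eq; rewrite !mxE /= evB. Qed.

Lemma evv_neq u v : gpos (gdot (gvsub u v) (gvsub u v)) -> evv u != evv v.
Proof.
move=> /ev_gt0; apply: contraTneq => h.
by rewrite ev_gdot evv_sub h subrr /dot mulmx0 mxE ltxx.
Qed.

Definition mirror (i : nat) : 'M[R]_3 := nth 1%:M [:: R0 R; R1 R; R2 R] i.

Lemma mulmx3E (A : 'M[R]_3) (x : 'cV[R]_3) i :
  (A *m x) i 0 = A i 0 * x 0 0 + A i 1 * x 1 0 + A i 2 * x 2 0.
Proof. by have := dotE (row i A) x; rewrite /dot -row_mul !mxE. Qed.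

Lemma mirror_doubled i u : (i < 3)%N ->
  mirror i *m evv u = 2^-1 *: evv (gmulmx (doubled_mirror i) u).
Proof.
have e0 : ev g0 = 0 by rewrite /ev /=; ring.
have e1 : ev g1 = 1 by rewrite /ev /=; ring.
have e2 : ev g2 = 2 by rewrite /ev /=; ring.
have ephi : ev gphi = phi R by rewrite /ev /=; ring.
case: i => [|[|[|//]]] _; apply: cV3_eq; rewrite mulmx3E [in RHS]mxE !evvE
  ?[R0 R _ _]mxE ?[R2 R _ _]mxE ?[R1 R _ _]mxE ?[mx3 _ _ _]mxE /=
  !(evD, evM, evN, e0, e1, e2, ephi); by field.
Qed.

Lemma mirror_involutive i : (i < 3)%N -> mirror i *m mirror i = 1%:M.
Proof.
move=> hi; have p2 := @phi_sqr R.
apply/matrixP => j k; rewrite [LHS]mxE !big_ord_recl big_ord0 /mirror.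
case: i hi => [|[|[|//]]] _;
case: j => -[|[|[|//]]] j; case: k => -[|[|[|//]]] k; rewrite !mxE /=.
all: try by ring.
all: move: (phi R) p2 => p p2.
all: by field: p2.
Qed.

End Evaluation.

(** * The icosahedral group as a list of permutations *)

Section Symmetries.
Local Open Scope classical_set_scope.
Local Open Scope ring_scope.

Variable R : realType.
Implicit Types (g h : Ih R) (p q : seq nat) (l k : nat).

Definition corner (l : nat) : 'cV[R]_3 := evv R (node l).

Lemma mirror_Ih i : (i < 3)%N -> @Ih_set R (mirror R i).
Proof.
move=> hi G [_ +]; apply.
by case: i hi => [|[|[|//]]] _; rewrite /mirror /=; [left; left|left; right|right].
Qed.

(** Induction on words works without inverses since the generators are
    involutions. *)
Lemma Ih_set_ind (Q : 'M[R]_3 -> Prop) : Q 1%:M ->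
  (forall i A, (i < 3)%N -> Q A -> Q (mirror R i *m A)) ->
  forall A, Ih_set A -> Q A.
Proof.
move=> Q1 QM A IA.
pose word (s : seq nat) : 'M[R]_3 := foldr (fun i B => mirror R i *m B) 1%:M s.
have word_cat s t : word (s ++ t) = word s *m word t.
  by elim: s => [|i s IH] /=; rewrite ?mul1mx// IH mulmxA.
have word_rev s : all (ltn^~ 3) s -> word (rev s) *m word s = 1%:M.
  elim: s => [|i s IH] /=; first by rewrite mulmx1.
  move=> /andP[hi /IH hs]; rewrite rev_cons -cats1 word_cat /= mulmx1.
  by rewrite -mulmxA [mirror R i *m (_ *m _)]mulmxA mirror_involutive// mul1mx.
have [s hs ->] : exists2 s, all (ltn^~ 3) s & A = word s.
  apply: (IA [set A | exists2 s, all (ltn^~ 3) s & A = word s]); split.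
    split=> /=.
    - by move=> _ [s /word_rev/mulmx1_unit[_ ?] ->].
    - by exists [::].
    - move=> _ _ [s hs ->] [t ht ->]; exists (s ++ t); rewrite ?word_cat//.
      by rewrite all_cat hs.
    - move=> _ [s hs ->]; exists (rev s); first by rewrite all_rev.
      have [_ u] := mulmx1_unit (word_rev s hs).
      by rewrite -[LHS]mul1mx -(word_rev s hs) mulmxK.
  by move=> _ [[->|->]|->] /=; [exists [:: 0%N]|exists [:: 1%N]|exists [:: 2%N]];
    rewrite //= mulmx1.
elim: s hs => [//|i s IH] /= /andP[hi /IH]; exact: QM.
Qed.

Lemma corner_inj l k : (l < 32)%N -> (k < 32)%N -> corner l = corner k -> l = k.
Proof.
move=> hl hk; apply: contra_eq => lk.
exact/evv_neq/nodes_separated.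
Qed.

Lemma mirror_corner i l : (i < 3)%N -> (l < 32)%N ->
  mirror R i *m corner l = corner (nth 0%N (mirror_perm i) l).
Proof.
move=> hi hl; have [_ e] := mirror_permP hi hl.
by rewrite /corner mirror_doubled// (evv_double R e) scalerA mulVf ?pnatr_eq0// scale1r.
Qed.

Definition permutes (A : 'M[R]_3) p :=
  size p = 32%N /\ forall l, (l < 32)%N -> A *m corner l = corner (nth 0%N p l).

Lemma permutes1 : permutes 1%:M idperm.
Proof. by split=> // l hl; rewrite mul1mx nth_iota. Qed.

Lemma permutesM A B p q : q \in elements ->
  (forall l, (l < 32)%N -> A *m corner l = corner (nth 0%N p l)) ->
  permutes B q -> permutes (A *m B) (perm_comp p q).
Proof.
move=> hq Ap [sq Bq]; split=> [|l hl]; first by rewrite size_map.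
rewrite -mulmxA Bq// Ap ?elements_bound//.
by rewrite (nth_map 0%N) ?sq.
Qed.

(** The vertices span the space: four corners of a cube already do. *)
Lemma dot_corners_eq0 (c : 'rV[R]_3) :
  (forall l, (l < 32)%N -> dot c (corner l) = 0) -> c = 0.
Proof.
move=> c0; have {}c0 u : u \in nodes -> dot c (evv R u) = 0.
  by move=> /node_index[l hl <-]; exact: c0.
have /and5P[/c0 h1 /c0 h2 /c0 h3 /c0 h4 _] := nodes_signed_cube.
move: h1 h2 h3 h4; rewrite !dotE !evvE /= !evN.
have -> : ev R g1 = 1 by rewrite /ev /=; ring.
move=> h1 h2 h3 h4; apply: (can_inj trmxK); rewrite trmx0.
by apply: cV3_eq; rewrite !mxE; lra.
Qed.

Lemma permutes_inj A B p : permutes A p -> permutes B p -> A = B.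
Proof.
move=> [_ hA] [_ hB]; apply/eqP; rewrite -subr_eq0; apply/eqP/row_matrixP => i.
rewrite row0; apply: dot_corners_eq0 => l hl.
by rewrite /dot -row_mul mulmxBl hA// hB// subrr row0 mxE.
Qed.

(** The vertices being distinct, the permutation is determined by the matrix. *)
Lemma permutes_fun A p q : p \in elements -> q \in elements ->
  permutes A p -> permutes A q -> p = q.
Proof.
move=> hp hq [sp Ap] [sq Aq]; apply: (@eq_from_nth _ 0%N); rewrite sp ?sq// => l hl.
by apply: corner_inj; rewrite ?elements_bound// -Ap// Aq.
Qed.

Lemma Ih_set_permutes A : Ih_set A -> exists2 p, p \in elements & permutes A p.
Proof.
move: A; apply: Ih_set_ind => [|i A hi [p hp Ap]].
  by exists idperm; [exact: elements_id|exact: permutes1].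
exists (perm_comp (mirror_perm i) p); first exact: elements_mirror.
by apply: permutesM => // l; exact: mirror_corner.
Qed.

Lemma elements_Ih p : p \in elements -> exists g : Ih R, permutes (mat g) p.
Proof.
move=> hp; suff [A IA Ap] : exists2 A, @Ih_set R A & p \in elements /\ permutes A p.
  by case: Ap; exists (SigSub (mem_set IA)).
move: p hp; apply: elements_ind => [|i p hi [A IA [hp Ap]]].
  exists 1%:M; first exact: Ih_set1.
  by split; [exact: elements_id|exact: permutes1].
exists (mirror R i *m A); first by apply: Ih_setM => //; exact: mirror_Ih.
split; first exact: elements_mirror.
by apply: permutesM => // l; exact: mirror_corner.
Qed.

(** The embedding of the group in the permutations of the vertices. *)
Definition vperm g : seq nat := projT1 (cid2 (Ih_set_permutes (matP g))).

Lemma vperm_elements g : vperm g \in elements.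
Proof. by rewrite /vperm; case: cid2. Qed.

Lemma vperm_permutes g : permutes (mat g) (vperm g).
Proof. by rewrite /vperm; case: cid2. Qed.

Lemma vpermE g l : (l < 32)%N -> mat g *m corner l = corner (nth 0%N (vperm g) l).
Proof. by case: (vperm_permutes g) => _; apply. Qed.

Lemma vperm_lt g l : (l < 32)%N -> (nth 0 (vperm g) l < 32)%N.
Proof. exact/elements_bound/vperm_elements. Qed.

Lemma vperm_inj : injective vperm.
Proof.
move=> g h e; apply/mat_inj/(permutes_inj (vperm_permutes g)).
by rewrite e; exact: vperm_permutes.
Qed.

Lemma vperm_onto p : p \in elements -> exists g, vperm g = p.
Proof.
move=> hp; have [g gp] := elements_Ih hp; exists g.
exact: permutes_fun (vperm_elements g) hp (vperm_permutes g) gp.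
Qed.

Lemma vperm1 : vperm 1%g = idperm.
Proof.
apply: (permutes_fun (A := 1%:M)).
- exact: vperm_elements.
- exact: elements_id.
- exact: (vperm_permutes 1%g).
- exact: permutes1.
Qed.

Lemma perm_compE p q l : (l < size q)%N ->
  nth 0%N (perm_comp p q) l = nth 0%N p (nth 0%N q l).
Proof. by move=> hl; rewrite (nth_map 0%N). Qed.

Lemma vpermM g h : vperm (g * h)%g = perm_comp (vperm g) (vperm h).
Proof.
have s (k : Ih R) : size (vperm k) = 32%N by apply/elements_size/vperm_elements.
apply: (@eq_from_nth _ 0%N); rewrite ?size_map s// => l hl.
rewrite perm_compE ?s//; apply: corner_inj; rewrite ?vperm_lt//.
by rewrite -!vpermE ?vperm_lt// matM mulmxA.
Qed.

Lemma vpermX g n : vperm (g ^+ n)%g = perm_pow (vperm g) n.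
Proof. by elim: n => [|n IH]; [exact: vperm1|rewrite expgS vpermM IH]. Qed.

(** Choosing a preimage of each of the 120 listed permutations enumerates the
    group. *)
Lemma Ih_finite : exists s : seq (Ih R), finite_axiom s.
Proof.
have /choice[f fK] : forall p, exists g, p \in elements -> vperm g = p.
  move=> p; case: (boolP (p \in elements)) => [/vperm_onto[g <-]|_]; first by exists g.
  by exists 1%g.
exists (map f elements); apply: Finite.uniq_enumP.
  rewrite map_inj_in_uniq ?elements_uniq// => p q hp hq e.
  by rewrite -(fK p hp) e fK.
move=> g; suff -> : g \in map f elements by [].
apply/mapP; exists (vperm g); first exact: vperm_elements.
by apply: vperm_inj; rewrite fK// vperm_elements.
Qed.

Definition Ih_enum : seq (Ih R) := sval (cid Ih_finite).

Lemma Ih_enumP : finite_axiom Ih_enum.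
Proof. by rewrite /Ih_enum; case: cid. Qed.

End Symmetries.

HB.instance Definition _ (R : realType) :=
  Choice_isCountable.Build (Ih R) (@fin_pickleK _ _ (@Ih_enumP R)).
HB.instance Definition _ (R : realType) := isFinite.Build (Ih R) (@Ih_enumP R).

(** * Classification of the faces *)

Section FaceClassification.
Local Open Scope classical_set_scope.
Local Open Scope ring_scope.

Variable R : realType.
Implicit Types (g h : Ih R) (p q : seq nat) (l k : nat).
Local Notation P := (@triacontahedron R).

Lemma corner_first : corner R 0 = vec3 1 1 1.
Proof.
rewrite /corner node_first.
by apply: cV3_eq; rewrite !evvE !mxE /= /ev /=; ring.
Qed.

Lemma corner_first_v' : corner R first_v' = vec3 0 1 (phi R).
Proof.
rewrite /corner; have [_ ->] := first_v'P.
by apply: cV3_eq; rewrite !evvE !mxE /= /ev /=; ring.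
Qed.

Lemma v_verticesP x : @v_vertices R x <-> exists2 l, (l < 20)%N & x = corner R l.
Proof.
rewrite /v_vertices /Ih_orbit -corner_first; split.
  move=> [g _ <-]; rewrite vpermE//.
  have [h _] := elements_orbits (vperm_elements g).
  by exists (nth 0%N (vperm g) 0).
move=> [l hl ->]; have l32 : (l < 32)%N by exact: leq_trans hl _.
have [p hp] := elements_transitive l32; rewrite hl => pl.
by have [g gp] := vperm_onto R hp; exists g => //; rewrite vpermE// gp pl.
Qed.

Lemma v'_verticesP x :
  @v'_vertices R x <-> exists2 l, (20 <= l < 32)%N & x = corner R l.
Proof.
have [f32 _] := first_v'P.
rewrite /v'_vertices /Ih_orbit -corner_first_v'; split.
  move=> [g _ <-]; rewrite vpermE//.
  have [_ h] := elements_orbits (vperm_elements g).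
  by exists (nth 0%N (vperm g) first_v'); rewrite ?h ?vperm_lt.
move=> [l /andP[hl l32] ->].
have [p hp] := elements_transitive l32; rewrite ltnNge hl /= => pl.
by have [g gp] := vperm_onto R hp; exists g => //; rewrite vpermE// gp pl.
Qed.

Lemma triacontahedronE :
  P = convex_hull [set x | exists2 l, (l < 32)%N & x = corner R l].
Proof.
congr convex_hull; apply/seteqP; split=> x /=.
  move=> [/v_verticesP[l hl ->]|/v'_verticesP[l /andP[_ hl] ->]]; exists l => //.
  exact: leq_trans hl _.
move=> [l hl ->]; case: (ltnP l 20) => h; [left|right].
  by apply/v_verticesP; exists l.
by apply/v'_verticesP; exists l; rewrite ?h.
Qed.

Lemma corner_triacontahedron l : (l < 32)%N -> P (corner R l).
Proof.
by move=> hl C [_]; rewrite /= => sC; apply: sC; case: (ltnP l 20) => h;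
  [left; apply/v_verticesP|right; apply/v'_verticesP]; exists l; rewrite ?h.
Qed.

Definition facet (n : gvec) : set 'cV[R]_3 :=
  P `&` [set x | dot (evv R n)^T x = ev R height].

Lemma mem_corners n l : (l \in corners n) = (l < 32)%N && (gdot n (node l) == height).
Proof. by rewrite mem_filter mem_iota andbC. Qed.

(** The vertices that are not listed in [corners n] are strictly below the
    plane. *)
Lemma facet_corner n l : n \in normals -> (l < 32)%N ->
  facet n (corner R l) <-> l \in corners n.
Proof.
move=> hn hl; rewrite mem_corners hl /= /facet /corner /= -ev_gdot; split.
  move=> [_ e]; case: (normals_support hn hl) => [->//|/(@ev_gt0 R)].
  by rewrite evB e subrr ltxx.
by move=> /eqP ->; split=> //; exact: corner_triacontahedron.
Qed.

Lemma vol_affine1 (t : R) x y v w :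
  vol (t *: x + (1 - t) *: y) v w = t * vol x v w + (1 - t) * vol y v w.
Proof. by rewrite /vol !mxE; ring. Qed.

Lemma vol_affine2 (t : R) x y v w :
  vol v (t *: x + (1 - t) *: y) w = t * vol v x w + (1 - t) * vol v y w.
Proof. by rewrite /vol !mxE; ring. Qed.

Lemma vol_affine3 (t : R) x y v w :
  vol v w (t *: x + (1 - t) *: y) = t * vol v w x + (1 - t) * vol v w y.
Proof. by rewrite /vol !mxE; ring. Qed.

Lemma vol_swap12 (x y z : 'cV[R]_3) : vol y x z = - vol x y z.
Proof. by rewrite /vol; ring. Qed.

Lemma vol_swap23 (x y z : 'cV[R]_3) : vol x z y = - vol x y z.
Proof. by rewrite /vol; ring. Qed.

Lemma vol_eq (x y : 'cV[R]_3) : vol x x y = 0.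
Proof. by rewrite /vol; ring. Qed.

(** The polyhedron is symmetric about the origin, so a form bounded above by a
    nonpositive number on it vanishes on it. *)
Lemma supporting_bound_gt0 (c : 'rV[R]_3) b : c != 0 ->
  (forall x, P x -> dot c x <= b) -> 0 < b.
Proof.
move=> c0 cb; rewrite ltNge; apply: contra c0 => b0; apply/eqP.
apply: dot_corners_eq0 => l hl; have [k hk kl] := nodes_opposite hl.
have e0 : ev R g0 = 0 by rewrite /ev /=; ring.
have kE : corner R k = - corner R l.
  rewrite /corner kl evv_sub; have -> : evv R (g0, g0, g0) = 0.
    by apply: cV3_eq; rewrite !mxE /= e0.
  exact: sub0r.
have h1 := cb _ (corner_triacontahedron hl).
have := cb _ (corner_triacontahedron hk).
by rewrite kE -[- _]scaleN1r dotZ; lra.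
Qed.

(** Suppose that every three vertices in the plane are linearly dependent.  The
    determinant is affine in each argument, so one argument at a time can be
    moved from the vertices in the plane to the whole section, which they
    generate; then [vol x y z] is zero. *)
Lemma supporting_plane_corners (c : 'rV[R]_3) b x y z :
  (forall x, P x -> dot c x <= b) ->
  [/\ P x, P y & P z] -> [/\ dot c x = b, dot c y = b & dot c z = b] ->
  vol x y z != 0 ->
  exists i j k, [/\ (i < j)%N, (j < k)%N & (k < 32)%N] /\
    [/\ dot c (corner R i) = b, dot c (corner R j) = b, dot c (corner R k) = b
      & vol (corner R i) (corner R j) (corner R k) != 0].
Proof.
move=> cb [Px Py Pz] [cx cy cz] /eqP v0; apply: contrapT => none; apply: v0.
pose S := [set x | exists2 l, (l < 32)%N & x = corner R l].
have Sb u : S u -> dot c u <= b.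
  by move=> [l hl ->]; apply: cb; exact: corner_triacontahedron.
have lin (Q : set 'cV[R]_3) :
    (forall l, (l < 32)%N -> dot c (corner R l) = b -> Q (corner R l)) ->
    (forall u v (t : R), Q u -> Q v -> Q (t *: u + (1 - t) *: v)) ->
    forall u, P u -> dot c u = b -> Q u.
  rewrite triacontahedronE => SQ Qa.
  apply: (@supporting_slice_sub R S Q c b) => // _ [l hl ->].
  exact: SQ.
have ordered i j k : (i < j)%N -> (j < k)%N -> (k < 32)%N ->
    dot c (corner R i) = b -> dot c (corner R j) = b -> dot c (corner R k) = b ->
    vol (corner R i) (corner R j) (corner R k) = 0.
  move=> ij jk hk ci cj ck; apply: contrapT => /eqP v0; apply: none.
  by exists i, j, k.
(* The determinant is alternating, so increasing triples suffice. *)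
have corners0 i j k : (i < 32)%N -> (j < 32)%N -> (k < 32)%N ->
    dot c (corner R i) = b -> dot c (corner R j) = b -> dot c (corner R k) = b ->
    vol (corner R i) (corner R j) (corner R k) = 0.
  move=> hi hj hk ci cj ck.
  case: (ltngtP i j) => [ij|ij|->]; last exact: vol_eq.
  - case: (ltngtP j k) => [jk|jk|->]; first exact: ordered.
    + rewrite vol_swap23; case: (ltngtP i k) => [ik|ik|->].
      * by rewrite ordered ?oppr0.
      * by rewrite vol_swap12 ordered ?oppr0.
      * by rewrite vol_eq oppr0.
    + by rewrite vol_swap12 vol_swap23 vol_eq oppr0 oppr0.
  rewrite vol_swap12; case: (ltngtP i k) => [ik|ik|->].
  - by rewrite ordered ?oppr0.
  - rewrite vol_swap23; case: (ltngtP j k) => [jk|jk|->].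
    + by rewrite ordered ?oppr0.
    + by rewrite vol_swap12 ordered ?oppr0.
    + by rewrite vol_eq !oppr0.
  - by rewrite vol_swap12 vol_swap23 vol_eq !oppr0.
have step1 j k : (j < 32)%N -> (k < 32)%N ->
    dot c (corner R j) = b -> dot c (corner R k) = b ->
    forall u, P u -> dot c u = b -> vol u (corner R j) (corner R k) = 0.
  move=> hj hk cj ck; apply: lin => [l hl cl|u v t]; first exact: corners0.
  by rewrite vol_affine1 => -> ->; rewrite !mulr0 addr0.
have step2 k : (k < 32)%N -> dot c (corner R k) = b ->
    forall u v, P u -> P v -> dot c u = b -> dot c v = b -> vol u v (corner R k) = 0.
  move=> hk ck u v Pu Pv cu; move: v Pv.
  apply: lin => [l hl cl|v w t]; first exact: step1.
  by rewrite vol_affine2 => -> ->; rewrite !mulr0 addr0.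
move: z Pz cz; apply: lin => [l hl cl|v w t]; first exact: step2.
by rewrite vol_affine3 => -> ->; rewrite !mulr0 addr0.
Qed.

(** By Cramer's rule, both [c] and the normal [n] of the facet found by
    [coplanar_nodes] are multiples of the form [plane] through three common
    vertices. *)
Lemma face_is_facet F : is_face P F -> exists2 n, n \in normals & F = facet n.
Proof.
move=> [[c [b [c0 cb ->]]] [x [y [z [[Px /= cx] [Py /= cy] [Pz /= cz] rk]]]]].
have b0 : 0 < b by exact: supporting_bound_gt0 c0 cb.
have v0 : vol x y z != 0 by apply: (@vol_neq0 R c b) => //; rewrite gt_eqF.
have [//|//|i [j [k [[ij jk hk] [ci cj ck]]]]] :=
  supporting_plane_corners cb _ _ v0.
set D := vol _ _ _ => D0.
have cE u : D * dot c u = b * plane (corner R i) (corner R j) (corner R k) u.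
  exact: cramer_plane.
have dE : ev R (gdot (gplane (node i) (node j) (node k)) (node i)) = D.
  by rewrite ev_plane plane_at.
case: (coplanar_nodes ij jk hk) => [d0|[l hl /(@ev_gt0 R)]|[q]]; last first.
- move=> /rhombi_normal[n hn ->]; rewrite !mem_corners.
  move=> -[/andP[_ /eqP ni] /andP[_ /eqP nj] /andP[_ /eqP nk]].
  exists n => //.
  have nE u : D * dot (evv R n)^T u
      = ev R height * plane (corner R i) (corner R j) (corner R k) u.
    by apply: cramer_plane; rewrite /corner -ev_gdot ?ni ?nj ?nk.
  have h0 : ev R height != 0.
    by rewrite gt_eqF// ev_gt0.
  have E u : ev R height * dot c u = b * dot (evv R n)^T u.
    by apply: (mulfI D0); rewrite mulrCA cE [RHS]mulrCA nE mulrCA.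
  apply/seteqP; split=> u /= [Pu hu]; split=> //=.
    move: (E u); rewrite [dot c u]hu mulrC => /mulfI ->//; exact: lt0r_neq0.
  by move: (E u); rewrite hu [RHS]mulrC => /(mulfI h0).
- rewrite evM evB dE ev_plane -/corner => h.
  have := cb _ (corner_triacontahedron hl); rewrite -/(dot c _) => cl.
  have := cE (corner R l); rewrite /corner => e.
  exfalso; move: (mulr_gt0 b0 h); rewrite mulrCA mulrBr -e.
  have : D ^+ 2 * (dot c (corner R l) - b) <= 0.
    by rewrite mulr_ge0_le0 ?sqr_ge0// subr_le0.
  rewrite /corner; nra.
- by move: D0; rewrite -dE d0 /ev /= mul0r addr0 eqxx.
Qed.

End FaceClassification.

(** * The faces as a list of rhombi *)

Section FaceCodes.
Local Open Scope classical_set_scope.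
Local Open Scope ring_scope.

Variable R : realType.
Implicit Types (g h : Ih R) (F : faces R) (p q : seq nat) (l k : nat).

Definition face_normal F : gvec := projT1 (cid2 (face_is_facet (ptsP F))).

Definition rhombus F : seq nat := corners (face_normal F).

Lemma face_normalP F : face_normal F \in normals /\ pts F = facet (face_normal F).
Proof. by rewrite /face_normal; case: cid2. Qed.

Lemma rhombus_rhombi F : rhombus F \in rhombi.
Proof. by apply: corners_rhombi; case: (face_normalP F). Qed.

Lemma rhombus_lt F l : l \in rhombus F -> (l < 32)%N.
Proof. by rewrite mem_corners => /andP[]. Qed.

Lemma rhombusP F l : (l < 32)%N -> pts F (corner R l) <-> l \in rhombus F.
Proof. by move=> hl; have [hn ->] := face_normalP F; exact: facet_corner. Qed.

Lemma face_normal_inj F G : rhombus F = rhombus G -> face_normal F = face_normal G.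
Proof.
have [hF _] := face_normalP F; have [hG _] := face_normalP G.
exact: (corners_inj hF hG).
Qed.

Lemma rhombus_inj : injective rhombus.
Proof.
move=> F G e; apply: val_inj; change (pts F = pts G).
have [_ ->] := face_normalP F; have [_ ->] := face_normalP G.
by rewrite (face_normal_inj e).
Qed.

Lemma rhombus_act g F :
  rhombus (face_act g F) = face_image (vperm g) (rhombus F).
Proof.
have -> : rhombus (face_act g F) = [seq l <- iota 0 32 | l \in rhombus (face_act g F)].
  rewrite {1}/rhombus /corners; apply: eq_in_filter => l; rewrite mem_iota /= => hl.
  by rewrite mem_corners hl.
apply: eq_in_filter => l; rewrite mem_iota /= => hl.
apply/idP/mapP => [/(rhombusP _ hl)[x Fx xl]|[k hk ->]].
  pose k := nth 0%N (vperm g^-1%g) l.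
  have hk : (k < 32)%N by exact: vperm_lt.
  have xk : x = corner R k.
    by rewrite /k -vpermE// -xl matV mulKmx// mat_unit.
  exists k; first by apply/rhombusP => //; rewrite -xk.
  by apply: (@corner_inj R) => //; rewrite ?vperm_lt// -vpermE// -xk.
have k32 := rhombus_lt hk.
apply/rhombusP; first exact: vperm_lt.
rewrite -vpermE//; exists (corner R k) => //.
exact/(rhombusP _ k32).
Qed.

Lemma faces_transitive F q : q \in rhombi -> exists g, rhombus (face_act g F) = q.
Proof.
move=> hq; have [p hp e] := rhombi_transitive (rhombus_rhombi F) hq.
by have [g gp] := vperm_onto R hp; exists g; rewrite rhombus_act gp.
Qed.

(** The group acts transitively on the rhombi, so if there is one face then
    each of the 30 rhombi comes from a face. *)
Lemma faces_finite : exists s : seq (faces R), finite_axiom s.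
Proof.
have [[F0 _]|noF] := pselect (exists F : faces R, True); last first.
  by exists [::] => F; case: noF; exists F.
have /choice[f fK] : forall q, exists G, q \in rhombi -> rhombus G = q.
  move=> q; case: (boolP (q \in rhombi)) => [/(faces_transitive F0)[g <-]|_].
    by exists (face_act g F0).
  by exists F0.
exists (map f rhombi); apply: Finite.uniq_enumP.
  rewrite map_inj_in_uniq; first exact: rhombi_uniq.
  by move=> p q hp hq e; rewrite -(fK p hp) e (fK q hq).
move=> F; suff -> : F \in map f rhombi by [].
apply/mapP; exists (rhombus F); first exact: rhombus_rhombi.
by apply: rhombus_inj; rewrite (fK _ (rhombus_rhombi F)).
Qed.

Definition faces_enum : seq (faces R) := sval (cid faces_finite).

Lemma faces_enumP : finite_axiom faces_enum.
Proof. by rewrite /faces_enum; case: cid. Qed.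

End FaceCodes.

HB.instance Definition _ (R : realType) := Choice.on (faces R).
HB.instance Definition _ (R : realType) :=
  Choice_isCountable.Build (faces R) (@fin_pickleK _ _ (@faces_enumP R)).
HB.instance Definition _ (R : realType) := isFinite.Build (faces R) (@faces_enumP R).

Section Kinds.
Local Open Scope classical_set_scope.
Local Open Scope ring_scope.

Variable R : realType.
Implicit Types (g h k : Ih R) (F G : faces R).

Definition fixes_on (V : set 'cV[R]_3) g F : Prop :=
  forall x, pts F x -> V x -> mat g *m x = x.

(** Stated with the two orbits of vertices, the kind is visibly invariant under
    conjugation; [kindE] makes it computable. *)
Definition kind g F : bool * bool :=
  (`[< fixes_on (@v_vertices R) g F >], `[< fixes_on (@v'_vertices R) g F >]).

Lemma kindE g F : kind g F = fixtype (vperm g) (rhombus F).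
Proof.
congr pair; apply/asboolP/allP => [fixF l hl|fixF x Fx Vx].
- apply/implyP => l20; have l32 := rhombus_lt hl.
  apply/eqP/(@corner_inj R); rewrite ?vperm_lt// -vpermE//.
  by apply: fixF; [exact/rhombusP|apply/v_verticesP; exists l].
- case/v_verticesP: Vx => l l20 xl; have l32 : (l < 32)%N by exact: leq_trans l20 _.
  rewrite xl vpermE//; congr (corner R _); apply/eqP.
  move: (fixF l); rewrite l20; apply.
  by apply/rhombusP; rewrite -?xl.
- apply/implyP => l20; have l32 := rhombus_lt hl.
  apply/eqP/(@corner_inj R); rewrite ?vperm_lt// -vpermE//.
  by apply: fixF; [exact/rhombusP|apply/v'_verticesP; exists l; rewrite ?l20].
- case/v'_verticesP: Vx => l /andP[l20 l32] xl.
  rewrite xl vpermE//; congr (corner R _); apply/eqP.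
  move: (fixF l); rewrite l20; apply.
  by apply/rhombusP; rewrite -?xl.
Qed.

Lemma stabilizer_kind_inj F g h :
  face_act g F = F -> face_act h F = F -> kind g F = kind h F -> g = h.
Proof.
move=> gF hF; rewrite !kindE => e; apply: vperm_inj.
have u := rhombi_stabilizers (rhombus_rhombi F).
have mem_stab k : face_act k F = F ->
    vperm k \in [seq p <- elements | face_image p (rhombus F) == rhombus F].
  by move=> kF; rewrite mem_filter vperm_elements andbT -rhombus_act kF.
exact: (uniq_map_inj_in u) (mem_stab g gF) (mem_stab h hF) e.
Qed.

Lemma face_actK g : cancel (face_act g) (face_act g^-1%g).
Proof. by move=> F; rewrite -face_actM mulVg face_act1. Qed.

Lemma kind_conj k g F : kind (k * g * k^-1)%g (face_act k F) = kind g F.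
Proof.
have conjE (y : 'cV[R]_3) :
    mat (k * g * k^-1)%g *m (mat k *m y) = mat k *m (mat g *m y).
  by rewrite !matM matV -!mulmxA mulKmx ?mat_unit.
have cancelk := can_inj (mulKmx (mat_unit k)).
have stable V : (forall g x, V x -> V (mat g *m x)) ->
    fixes_on V (k * g * k^-1)%g (face_act k F) <-> fixes_on V g F.
  move=> sV; split=> [fix_ x Fx Vx|fix_ _ [x Fx <-] Vx].
    by apply: cancelk; rewrite -conjE fix_ //; [exists x|exact: sV].
  rewrite conjE fix_//; have := sV k^-1%g _ Vx.
  by rewrite matV mulKmx ?mat_unit.
by congr pair; apply: asbool_equiv_eq; apply: stable => h x; exact: Ih_orbit_stable.
Qed.

Lemma faces_conj F G : exists k, face_act k F = G.
Proof.
have [k e] := faces_transitive F (rhombus_rhombi G).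
by exists k; apply: rhombus_inj.
Qed.

Variable D : tile_designs R.

Definition tiles_fixed g F : nat := #|[pred T : tile D | tile_act g (T, F) == (T, F)]|.

(** The action of [k] maps the tiles of [F] bijectively to those of
    [face_act k F], and intertwines [g] with its conjugate. *)
Lemma tiles_fixed_conj k g F :
  tiles_fixed (k * g * k^-1)%g (face_act k F) = tiles_fixed g F.
Proof.
pose move h G (T : tile D) := (tile_act h (T, G)).1.
have moveE h G T : tile_act h (T, G) = (move h G T, face_act h G).
  by rewrite [LHS]surjective_pairing tile_act_over.
have moveK h G : cancel (move h G) (move h^-1%g (face_act h G)).
  by move=> T; rewrite /move -moveE -tile_actM mulVg tile_act1.
have moveI : injective (move k F) := can_inj (moveK k F).
rewrite /tiles_fixed -[RHS](fintype.card_image moveI); apply: eq_card => T.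
have act_inj h x y : tile_act h x = tile_act h y -> x = y :> tile D * faces R.
  by move=> e; rewrite -(tile_act1 x) -(mulVg h) tile_actM e -tile_actM mulVg tile_act1.
have equiv S : (tile_act (k * g * k^-1)%g (move k F S, face_act k F)
      == (move k F S, face_act k F)) = (tile_act g (S, F) == (S, F)).
  rewrite -moveE -tile_actM mulgKV tile_actM.
  by apply/eqP/eqP => [/act_inj //|->].
apply/idP/fintype.imageP => [fixT|[S fixS ->]]; last by rewrite inE equiv.
exists (move k^-1%g (face_act k F) T); last first.
  by have := moveK k^-1%g (face_act k F) T; rewrite invgK face_actK => ->.
have E : move k F (move k^-1%g (face_act k F) T) = T.
  by have := moveK k^-1%g (face_act k F) T; rewrite invgK face_actK => ->.
by rewrite inE -equiv E.
Qed.

(** Conjugating by an element that maps [F] to [G] turns [g] into an element of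
    the stabilizer of [G] of the same kind, which is [h]. *)
Lemma tiles_fixed_kind F G g h : face_act g F = F -> face_act h G = G ->
  kind g F = kind h G -> tiles_fixed g F = tiles_fixed h G.
Proof.
move=> gF hG e; have [k kF] := faces_conj F G.
rewrite -(tiles_fixed_conj k) kF; congr tiles_fixed.
apply: (@stabilizer_kind_inj G) => //.
  by rewrite -{1}kF !face_actM face_actK gF.
by rewrite -{1}kF kind_conj.
Qed.
End Kinds.

(** * Counting orbits of tilings *)

Section Counting.
Variables (R : realType) (D : tile_designs R) (F0 : faces R).
Implicit Types (g h : Ih R) (F G : faces R) (p q : seq nat).
Local Notation ftiling := {ffun faces R -> tile D}.

Lemma tiling_act1 (tau : tiling D) : tiling_act 1%g tau = tau.
Proof.
by apply/esym/tiling_actP => F; rewrite face_act1 tile_act1.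
Qed.

Lemma tiling_actM g h (tau : tiling D) :
  tiling_act (g * h)%g tau = tiling_act g (tiling_act h tau).
Proof.
apply/esym/tiling_actP => F.
have /tiling_actP hE := erefl (tiling_act h tau).
have /tiling_actP gE := erefl (tiling_act g (tiling_act h tau)).
by rewrite tile_actM -hE -gE face_actM.
Qed.

(** The inverse turns the left action on tilings into a right action. *)
Definition ftiling_act (tau : ftiling) g : ftiling :=
  [ffun F => tiling_act g^-1%g tau F].

Lemma ftiling_actE (tau : ftiling) g :
  (ftiling_act tau g : faces R -> tile D) = tiling_act g^-1%g tau.
Proof. by apply/funext => F; rewrite ffunE. Qed.

Lemma ftiling_act1 (tau : ftiling) : ftiling_act tau 1%g = tau.
Proof. by apply/ffunP => F; rewrite ffunE invg1 tiling_act1. Qed.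

Lemma ftiling_actM (tau : ftiling) : act_morph ftiling_act tau.
Proof.
by move=> g h; apply/ffunP => F; rewrite !ffunE ftiling_actE invMg tiling_actM.
Qed.

Canonical ftiling_action := TotalAction ftiling_act1 ftiling_actM.

Definition orbit_set : {set {set ftiling}} :=
  orbit ftiling_action [set: Ih R] @: [set: ftiling].

Lemma tiling_orbits_card : (tiling_orbits D #= `I_#|orbit_set|)%card.
Proof.
pose f (i : 'I_#|orbit_set|) : set (tiling D) :=
  [set tau : tiling D | exists2 t : ftiling, t \in enum_val i & tau = t]%classic.
have f_inj : injective f.
  have memf k (t : ftiling) : f k t <-> t \in enum_val k.
    split=> [[u hu tu]|ht]; last by exists t.
    suff -> : t = u by [].
    by apply/ffunP => F; rewrite tu.
  move=> i j e; apply: enum_val_inj; apply/setP => t.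
  by apply/idP/idP => /memf; [rewrite e|rewrite -e] => /memf.
suff -> : tiling_orbits D = (f @` setT)%classic.
  rewrite card_eq_sym; apply: card_eq_trans card_II _.
  by rewrite card_eq_sym; apply: inj_card_eq => i j _ _; exact: f_inj.
have fE i (t : ftiling) : enum_val i = orbit ftiling_action [set: Ih R] t ->
    f i = tiling_orbit t.
  move=> e; apply/seteqP; split=> tau /=.
    move=> [u + ->]; rewrite e => /orbitP[g _ <-]; exists g^-1%g => //.
    by rewrite -ftiling_actE.
  move=> [g _ <-]; exists (ftiling_act t g^-1%g); last by rewrite ftiling_actE invgK.
  by rewrite e; apply/orbitP; exists g^-1%g; rewrite ?inE.
apply/seteqP; split=> S /=.
  move=> [tau _ <-]; pose t : ftiling := [ffun F => tau F].
  have tE : tau = t by apply/funext => F; rewrite ffunE.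
  have ot : orbit ftiling_action [set: Ih R] t \in orbit_set.
    by apply: imset_f; rewrite inE.
  exists (enum_rank_in ot (orbit ftiling_action [set: Ih R] t)) => //.
  by rewrite tE; apply: fE; rewrite enum_rankK_in.
move=> [i _ <-]; have /imsetP[t _ e] := enum_valP i.
by exists t => //; rewrite (fE _ _ e).
Qed.

Definition fixed_tilings g : {set ftiling} :=
  [set tau : ftiling |
    [forall F, tile_act g (tau F, F) == (tau (face_act g F), face_act g F)]].

Lemma perm_vperm : perm_eq (map (@vperm R) (enum {: Ih R})) elements.
Proof.
apply: uniq_perm.
- by rewrite (map_inj_uniq (@vperm_inj R)) enum_uniq.
- exact: elements_uniq.
move=> p; apply/mapP/idP => [[g _ ->]|/(vperm_onto R)[g <-]].
  exact: vperm_elements.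
by exists g; rewrite ?mem_enum.
Qed.

Lemma perm_rhombus : perm_eq (map (@rhombus R) (enum {: faces R})) rhombi.
Proof.
(* Generalized, since membership in [rhombi] is costly to compare. *)
move: rhombi rhombi_uniq (@rhombus_rhombi R) (faces_transitive F0) => s us mem_s onto_s.
apply: uniq_perm => // [|q]; first by rewrite (map_inj_uniq (@rhombus_inj R)) enum_uniq.
apply/mapP/idP => [[F _ ->]|/onto_s[g <-]]; first exact: mem_s.
by exists (face_act g F0); rewrite ?mem_enum.
Qed.

Lemma burnside : \sum_(g : Ih R) #|fixed_tilings g| = #|orbit_set| * 120.
Proof.
have cardI : #|[set: Ih R]| = 120.
  by rewrite cardsT cardE -(size_map (@vperm R)) (perm_size perm_vperm) size_elements.
have acts : [acts [set: Ih R], on [set: ftiling] | ftiling_action].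
  apply/fintype.subsetP => g _; rewrite !inE.
  by apply/fintype.subsetP => t _; rewrite !inE.
have := Frobenius_Cauchy (G := [set: Ih R]%G) acts; rewrite -/orbit_set cardI => <-.
rewrite [RHS](reindex_inj invg_inj) /=; apply: eq_big => [g|g _]; first by rewrite inE.
apply: eq_card => tau; rewrite finset.in_setI finset.in_setT inE.
apply/forallP/afix1P => [fixP|fixt F].
  have e : (tau : tiling D) = tiling_act g tau.
    by apply/tiling_actP => F; have /eqP <- := fixP F.
  by apply/ffunP => F; rewrite ffunE invgK -e.
have /tiling_actP e : (tau : tiling D) = tiling_act g tau.
  by rewrite -{1}fixt /= ftiling_actE invgK.
by apply/eqP; rewrite e.
Qed.

Lemma iter_tile_act g n z : iter n (@tile_act R D g) z = tile_act (g ^+ n)%g z.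
Proof. by elim: n => [|n IH]; rewrite ?tile_act1// iterS IH expgS tile_actM. Qed.

Lemma iter_face_act g n F : iter n (face_act g) F = face_act (g ^+ n)%g F.
Proof. by elim: n => [|n IH]; rewrite ?face_act1// iterS IH expgS face_actM. Qed.

Lemma rhombus_iter g n F :
  rhombus (iter n (face_act g) F) = iter n (face_image (vperm g)) (rhombus F).
Proof.
elim: n => [|n IH]; first by rewrite /=.
by rewrite (iterS n (face_act g)) rhombus_act IH iterS.
Qed.

(** The cycles of [g] on the faces are those of its permutation of the rhombi,
    and going round one of length [n] acts on tiles by [g ^ n]. *)
Lemma card_fixed_tilings (w : bool * bool -> nat) g :
  (forall h F, face_act h F = F -> tiles_fixed D h F = w (kind h F)) ->
  #|fixed_tilings g| = \prod_(t <- cycle_types (vperm g)) w t.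
Proof.
move=> wP; rewrite /cycle_types.
move: (cycles (vperm g)) (cyclesP (vperm_elements g)) => cs [cov ret].
have /choice[f fK] : forall q, exists G, q \in rhombi -> rhombus G = q.
  move=> q; case: (boolP (q \in rhombi)) => [/(faces_transitive F0)[h <-]|_].
    by exists (face_act h F0).
  by exists F0.
have cyc_rhombi c : c \in cs -> c.1 \in rhombi.
  move=> hc; rewrite -(perm_mem cov); apply/flatten_mapP; exists c; first exact: hc.
  by have [] := ret c hc; case: c.2 => //= n _ _; exact: mem_head.
pose s := [seq (f c.1, c.2) | c <- cs].
have s_cover : perm_eq (flatten [seq traject (face_act g) c.1 c.2 | c <- s])
    (enum {: faces R}).
  apply: (perm_map_inj (@rhombus_inj R)); rewrite (permPr perm_rhombus).
  rewrite -(permPr cov) map_flatten -!map_comp.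
  suff -> : [seq (map (@rhombus R) \o (fun c => traject (face_act g) c.1 c.2)
       \o (fun c => (f c.1, c.2))) c | c <- cs]
     = [seq traject (face_image (vperm g)) c.1 c.2 | c <- cs].
    exact: perm_refl.
  apply/eq_in_map => c hc /=; rewrite -[in RHS](fK _ (cyc_rhombi _ hc)).
  elim: c.2 (f c.1) => [//|n IH] F /=.
  by rewrite IH rhombus_act.
have s_return c : c \in s -> 0 < c.2 /\ iter c.2 (face_act g) c.1 = c.1.
  move=> /mapP[d hd ->] /=; have [d0 e] := ret d hd; split=> //.
  apply: rhombus_inj; rewrite rhombus_iter (fK _ (cyc_rhombi _ hd)); exact: e.
rewrite /fixed_tilings.
rewrite (card_fixed_sections (tile_act_over g) s_cover s_return).
rewrite big_map big_map big_seq [RHS]big_seq; apply: eq_bigr => c hc /=.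
have [_ e] := s_return _ (map_f (fun c => (f c.1, c.2)) hc).
rewrite /= iter_face_act in e.
transitivity (tiles_fixed D (g ^+ c.2)%g (f c.1)).
  by apply: eq_card => T; rewrite !inE iter_tile_act.
by rewrite wP// kindE vpermX (fK _ (cyc_rhombi _ hc)).
Qed.

End Counting.

(** * The symmetries of one face *)

Section Induced.
Local Open Scope classical_set_scope.
Local Open Scope ring_scope.

Variables (R : realType) (F : faces R).
Implicit Types (g h : Ih R) (s : pts F -> pts F).

Lemma induces_fixes (V : set 'cV[R]_3) g s : induces g s ->
  fixes_on V g F <-> forall x, V (val x) -> s x = x.
Proof.
move=> [_ sE]; split=> [fixF x Vx|fixs x Fx Vx].
  by apply: val_inj; rewrite sE fixF//; exact: set_mem (valP x).
by have := sE (SigSub (mem_set Fx)); rewrite fixs.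
Qed.

(** A symmetry of a face fixes the same corners as an element inducing it, and
    the fixed corners determine the element. *)
Lemma induces_inj g h s : induces g s -> induces h s -> g = h.
Proof.
move=> gs hs; apply: (@stabilizer_kind_inj _ F); [by case: gs|by case: hs|].
congr pair; apply: asbool_equiv_eq;
  by rewrite (induces_fixes _ gs) (induces_fixes _ hs).
Qed.

Lemma fixed_tiles_induced (D : tile_designs R) g s :
  induces g s -> fixed_tiles D s = tiles_fixed D g F.
Proof.
move=> gs; apply: eq_card => T; rewrite !inE.
apply/asboolP/eqP => [[h hs]|]; last by exists g.
by rewrite (induces_inj gs hs).
Qed.

Lemma rhombus_pair (P : pred nat) : size [seq l <- rhombus F | P l] = 2%N ->
  exists l k, [/\ l != k, l \in rhombus F, k \in rhombus F, P l & P k].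
Proof.
have u : uniq [seq l <- rhombus F | P l] by rewrite !filter_uniq// iota_uniq.
have sub l : l \in [seq l <- rhombus F | P l] -> P l /\ l \in rhombus F.
  by rewrite mem_filter => /andP.
case: {+}[seq l <- rhombus F | P l] u sub => [//|l [//|k [|//]]] /= /andP[+ _] sub _.
rewrite inE => lk; exists l, k.
have [] := sub l; first by rewrite mem_head.
have [] := sub k; first by rewrite !inE eqxx orbT.
by split.
Qed.

Lemma two_v_vertices : exists x y : pts F,
  [/\ v_vertices (val x), v_vertices (val y) & x <> y].
Proof.
have [/rhombus_pair[l [k [lk hl hk l20 k20]]] _] := rhombi_corners (rhombus_rhombi F).
have l32 := rhombus_lt hl; have k32 := rhombus_lt hk.
have Fl : pts F (corner R l) by apply/rhombusP.
have Fk : pts F (corner R k) by apply/rhombusP.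
exists (SigSub (mem_set Fl)), (SigSub (mem_set Fk)); split.
- by apply/v_verticesP; exists l.
- by apply/v_verticesP; exists k.
- by move=> /(congr1 val) /= /(corner_inj l32 k32)/eqP; apply/negP.
Qed.

Lemma two_v'_vertices : exists x y : pts F,
  [/\ v'_vertices (val x), v'_vertices (val y) & x <> y].
Proof.
have [_ /rhombus_pair[l [k [lk hl hk l20 k20]]]] := rhombi_corners (rhombus_rhombi F).
have l32 := rhombus_lt hl; have k32 := rhombus_lt hk.
have Fl : pts F (corner R l) by apply/rhombusP.
have Fk : pts F (corner R k) by apply/rhombusP.
exists (SigSub (mem_set Fl)), (SigSub (mem_set Fk)); split.
- by apply/v'_verticesP; exists l; rewrite ?l20.
- by apply/v'_verticesP; exists k; rewrite ?k20.
- by move=> /(congr1 val) /= /(corner_inj l32 k32)/eqP; apply/negP.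
Qed.

Lemma kind1 : kind 1%g F = (true, true).
Proof. by congr pair; apply/asboolP => x _ _; rewrite mat1 mul1mx. Qed.

(** The only fixed point of a half-turn is its center, and each type has two
    corners in the face. *)
Lemma kind_half_turn g s : induces g s -> half_turn s -> kind g F = (false, false).
Proof.
move=> gs [c sE].
have moves V : (exists x y : pts F, [/\ V (val x), V (val y) & x <> y]) ->
    ~ fixes_on V g F.
  move=> [x [y [Vx Vy xy]]] /(induces_fixes V gs) fixV; apply: xy; apply: val_inj.
  have center (z : pts F) : V (val z) -> val c = val z.
    move=> Vz; have sz := fixV z Vz; have := sE z; rewrite sz => /eqP.
    by rewrite -subr_eq0 opprB addrA -mulr2n -mulrnBl -scaler_nat scaler_eq0
      pnatr_eq0 /= subr_eq0 => /eqP ->.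
  by rewrite -(center x) ?(center y).
congr pair; apply/asboolP; apply: moves.
  exact: two_v_vertices.
exact: two_v'_vertices.
Qed.

Lemma diagonal_fix (V : set 'cV[R]_3) s :
  (forall x : pts F, convex_hull (pts F `&` V) (val x) -> s x = x) ->
  forall x : pts F, V (val x) -> s x = x.
Proof.
move=> fixd x Vx; apply: fixd => C [_ sub]; apply: sub.
by split; [exact: set_mem (valP x)|exact: Vx].
Qed.

Lemma swaps_moves (V : set 'cV[R]_3) g s : induces g s -> swaps V s ->
  (exists x y : pts F, [/\ V (val x), V (val y) & x <> y]) -> ~ fixes_on V g F.
Proof.
move=> gs sw [x [y [Vx Vy xy]]] /(induces_fixes V gs) fixV; apply: (xy).
by rewrite -(fixV x Vx); exact: sw.
Qed.

Lemma kind_short_flip g s : induces g s -> short_flip s -> kind g F = (true, false).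
Proof.
move=> gs [sw fixd]; congr pair; apply/asboolP.
  exact/(induces_fixes _ gs)/diagonal_fix.
exact/(swaps_moves gs sw)/two_v'_vertices.
Qed.

Lemma kind_long_flip g s : induces g s -> long_flip s -> kind g F = (false, true).
Proof.
move=> gs [sw fixd]; congr pair; apply/asboolP.
  exact/(swaps_moves gs sw)/two_v_vertices.
exact/(induces_fixes _ gs)/diagonal_fix.
Qed.

End Induced.

Definition monomial (w : bool * bool -> nat) (x : nat * nat * nat * nat) : nat :=
  w (true, true) ^ x.1.1.1 * w (false, false) ^ x.1.1.2
  * w (true, false) ^ x.1.2 * w (false, true) ^ x.2.

Lemma prod_cycle_types w p :
  \prod_(t <- cycle_types p) w t = monomial w (exponents p).
Proof.
rewrite /exponents; elim: (cycle_types p) => [|t ts IH]; first by rewrite big_nil.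
rewrite big_cons IH; case: t => [[] []]; rewrite /monomial /= !add0n add1n expnS; ring.
Qed.

(** Burnside's lemma combined with the census of the cycles. *)
Lemma card_orbit_set (R : realType) (D : tile_designs R) (F : faces R)
    (w : bool * bool -> nat) :
  (forall h G, face_act h G = G -> tiles_fixed D h G = w (kind h G)) ->
  let m := monomial w in
  #|orbit_set D| * 120 = m (30, 0, 0, 0) + 24 * m (6, 0, 0, 0)
    + 20 * m (10, 0, 0, 0) + 15 * m (14, 2, 0, 0) + m (15, 0, 0, 0)
    + 24 * m (3, 0, 0, 0) + 20 * m (5, 0, 0, 0) + 15 * m (13, 0, 2, 2).
Proof.
move=> wP m; rewrite -burnside.
have fixE g : #|fixed_tilings D g| = m (exponents (vperm g)).
  by rewrite (card_fixed_tilings F _ wP) prod_cycle_types.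
under eq_bigr do rewrite fixE.
rewrite -big_enum /= -(big_map (@vperm R) xpredT (fun p => m (exponents p))).
rewrite (perm_big _ (perm_vperm R)) -(big_map exponents xpredT m).
rewrite (perm_big _ cycle_census) !big_cat !big_nseq !iter_addn /=.
ring.
Qed.

Local Open Scope classical_set_scope.
Local Open Scope card_scope.
Local Open Scope ring_scope.

Theorem theorem14 (R : realType) (D : tile_designs R) (F : faces R)
    (r f rf : pts F -> pts F)
    (hr : induced_symmetries r) (hf : induced_symmetries f)
    (hrf : induced_symmetries rf)
    (r_half_turn : half_turn r) (f_short_flip : short_flip f)
    (rf_long_flip : long_flip rf)
    (t_id t_r t_f t_rf : nat)
    (ht_id : #|tile D| = t_id) (ht_r : fixed_tiles D r = t_r)
    (ht_f : fixed_tiles D f = t_f) (ht_rf : fixed_tiles D rf = t_rf) :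
  exists N : nat, tiling_orbits D #= `I_N /\
    N%:R = 120%:R^-1 *
      (t_id ^ 30 + 24 * t_id ^ 6 + 20 * t_id ^ 10 + 15 * t_id ^ 14 * t_r ^ 2
       + t_id ^ 15 + 24 * t_id ^ 3 + 20 * t_id ^ 5
       + 15 * t_id ^ 13 * t_f ^ 2 * t_rf ^ 2)%N%:R :> rat.
Proof.
case: hr => gr rP; case: hf => gf fP; case: hrf => grf rfP.
pose w (t : bool * bool) := match t with
  | (true, true) => t_id | (false, false) => t_r
  | (true, false) => t_f | (false, true) => t_rf end.
have wP h G : face_act h G = G -> tiles_fixed D h G = w (kind h G).
  move=> hG; case e : (kind h G) => [[] []] /=.
  - rewrite (tiles_fixed_kind D hG (face_act1 F)) ?kind1 ?e// -ht_id.
    by apply: eq_card => T; rewrite !inE tile_act1 eqxx.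
  - rewrite -ht_f (fixed_tiles_induced D fP).
    by apply: tiles_fixed_kind hG _ _; [case: fP|rewrite (kind_short_flip fP)].
  - rewrite -ht_rf (fixed_tiles_induced D rfP).
    by apply: tiles_fixed_kind hG _ _; [case: rfP|rewrite (kind_long_flip rfP)].
  - rewrite -ht_r (fixed_tiles_induced D rP).
    by apply: tiles_fixed_kind hG _ _; [case: rP|rewrite (kind_half_turn rP)].
exists #|orbit_set D|; split; first exact: tiling_orbits_card.
have /= := card_orbit_set F wP; rewrite /monomial /= !expn0 !muln1 => e.
apply: (canRL (mulKf _)); first by rewrite pnatr_eq0.
rewrite mulrC -natrM e; congr _%:R; ring.
Qed.
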